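(* There exists $\delta_0>0$ such that for every $\delta\in(0,\delta_0)$ there is a constant $C(\delta)>0$ with $$M_{n,\delta}>C(\delta)\sqrt{n}\qquad\text{for all } n\in\mathbb{N},\ n\ge 1 .$$
   Context: $\mathbb{T}$ is the unit circle, parametrized by $z=e^{i\theta}$. For $\delta\in(0,1)$ the Steklov class $S_\delta$ is the set of all Borel probability measures $\sigma$ on $\mathbb{T}$ (viewed as measures in $\theta$) such that the density $\sigma'$ (with respect to $d\theta$) satisfies $\sigma'(\theta)\ge \delta/(2\pi)$ at every Lebesgue point of $\sigma$ (i.e. for Lebesgue-a.e. $\theta$). For $\sigma\in S_\delta$, $\phi_n(z)=\phi_n(z;\sigma)$ denotes the orthonormal polynomial of degree $n$ (with positive leading coefficient): $\int \phi_n\overline{\phi_m}\,d\sigma=\delta_{n,m}$ (Kronecker symbol). Finally $$M_{n,\delta}=\sup_{\sigma\in S_\delta}\|\phi_n(\cdot;\sigma)\|_{L^\infty(\mathbb{T})}.$$ *)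

(* Defs.v *)
From HB Require Import structures.
From mathcomp Require Import all_boot all_order all_algebra.
From mathcomp Require Import complex.
From mathcomp Require Import all_classical all_reals all_analysis.

Set Implicit Arguments.
Unset Strict Implicit.
Unset Printing Implicit Defensive.

Import Order.TTheory GRing.Theory Num.Theory.
Import numFieldNormedType.Exports.

Local Open Scope classical_set_scope.
Local Open Scope ring_scope.

(* The unit circle is handled through the angle, which ranges over one period:
   z = cis theta with theta in [-pi, pi).  A Borel probability measure on the
   circle is thus a Borel probability measure on the line giving full mass to
   that interval. *)
Definition angles (R : realType) : set R := `[- pi, pi[%classic.
Arguments angles R _ : clear implicits.

Definition cis (R : realType) (theta : R) : R[i] :=
  Complex (cos theta) (sin theta).

(* sigma'(theta) = l: the mass of the arc of half-length r centred at theta,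
   divided by the length of the arc, tends to l as r -> 0+.  The arc wraps
   around the circle at theta = - pi, where this definition does not see the
   other half; that single point does not matter below. *)
Definition density_at (R : realType) (sigma : probability (measurableTypeR R) R)
    (theta l : R) : Prop :=
  (fine (sigma `]theta - r, theta + r[%classic) / (2 * r)) @[r --> 0^'+] --> l.

(* By Lebesgue's differentiation theorem the density exists at almost every
   theta, whatever sigma; only the lower bound is a constraint. *)
Definition Steklov (R : realType) (delta : R)
    (sigma : probability (measurableTypeR R) R) : Prop :=
  sigma (angles R) = 1%E /\
  {ae (@lebesgue_measure R), forall theta, angles R theta ->
     exists2 l, density_at sigma theta l & delta / (2 * pi) <= l}.

Definition cintegral (R : realType) (sigma : probability (measurableTypeR R) R)
    (f : R -> R[i]) : R[i] :=
  Complex (\int[sigma]_(theta in angles R) complex.Re (f theta))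
          (\int[sigma]_(theta in angles R) complex.Im (f theta)).

(* In R[i] the order relation 0 < a says that a is a positive real number. *)
Definition orthonormal_polys (R : realType)
    (sigma : probability (measurableTypeR R) R) (phi : nat -> {poly R[i]}) :
    Prop :=
  (forall n, size (phi n) = n.+1 /\ 0 < lead_coef (phi n)) /\
  (forall n m, cintegral sigma
     (fun theta => (phi n).[cis theta] * conjc (phi m).[cis theta])
     = (n == m)%:R).

Lemma measurable_angles (R : realType) :
  measurable (angles R : set (measurableTypeR R)).
Proof. exact: measurable_itv. Qed.

Definition Linfty_norm (R : realType) (p : {poly R[i]}) : \bar R :=
  Lnorm (mrestr (@lebesgue_measure R) (@measurable_angles R)) +oo%E
    (fun theta : measurableTypeR R => (Normc.normc p.[cis theta])%:E).

(* For sigma in the Steklov class the orthonormal system phi exists and is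
   unique. *)
Definition M (R : realType) (n : nat) (delta : R) : \bar R :=
  ereal_sup [set x | exists sigma, exists phi,
    [/\ Steklov delta sigma, orthonormal_polys sigma phi &
        x = Linfty_norm (phi n)]].

(* Main.v *)
(** Let [Q] be a polynomial of degree [n] all of whose zeros [x] lie on the
    circle, and put masses [m x] at these zeros next to the density [delta / 2 pi].
    Then [Q] has norm [sqrt delta * |Q|_2], whereas by Lagrange interpolation a
    polynomial [P] of degree less than [n] has [|P(1)| <= K * sum_x m x |P(x)|].
    Write [Q = b phi_n + P] with [P] of smaller degree: both [b] and [P] have norm at
    most [sqrt delta * |Q|_2], so if [K] is of the order of [|Q(1)|] and [delta] is
    small, then [b phi_n(1)] is at least [|Q(1)| / 2] and [phi_n(1)] is at least of the
    order of [|Q(1)| / |Q|_2].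

    To have [|Q|_2] bounded while [Q(1)] and [K] are of order [sqrt n], take
    [Q(z) = H(z) + z^n H(1/z)] with [H] a sum of analytic completions of Fejer kernels:
    a peak of height [sqrt n] and width [1/n], and a tail with
    [Re H >= c |theta|^(-1/4)].  As [H] has no zero in the closed disc, the zeros of [Q]
    are simple and on the circle, and the numbers [- H(x) / (x Q'(x))] are positive.
    They are the weights of a quadrature formula, and [m x] is this weight times a
    trigonometric polynomial bounded below by [c |theta|^(-3/4)]. *)

Require Import Defs.
From mathcomp Require Import all_boot all_order all_algebra.
From mathcomp Require Import separable complex ring lra zify.
From mathcomp Require Import all_classical all_reals all_analysis.
From mathcomp Require Import measurable_realfun ess_sup_inf.

Set Implicit Arguments.
Unset Strict Implicit.
Unset Printing Implicit Defensive.

Import Order.TTheory GRing.Theory Num.Theory.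
Import numFieldNormedType.Exports.

Local Open Scope classical_set_scope.
Local Open Scope ring_scope.

(** * Interpolation and self-reciprocal polynomials *)

(** The quotients [q x] of $Q$ by $X - x$ vanish at the other nodes and take the value $Q'(x)$ at
    $x$, so $p$ minus its interpolant has too many roots for its degree. It serves at $y = 0$ for
    the quadrature formula and at $y = 1$ for the bound on $R(1)$. *)
Lemma lagrange_eval (F : fieldType) (Q p : {poly F}) (rs : seq F) (y : F) :
  uniq rs -> all (root Q) rs -> {in rs, forall x, Q^`().[x] != 0} ->
  (size Q <= (size rs).+1)%N -> (size p <= size rs)%N -> y \notin rs ->
  p.[y] = Q.[y] * \sum_(x <- rs) p.[x] / (Q^`().[x] * (y - x)).
Proof.
move=> Urs /allP rootQ Q'0 szQ szp yrs.
pose q x := Q %/ ('X - x%:P).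
have Qq x : x \in rs -> Q = q x * ('X - x%:P).
  by move=> /rootQ; rewrite -dvdp_XsubCl => /divpK ->.
have Q'q x : x \in rs -> Q^`().[x] = (q x).[x].
  by move=> xrs; rewrite {1}(Qq x xrs) derivM derivXsubC !hornerE subrr mulr0 add0r.
pose r := p - \sum_(x <- rs) (p.[x] / Q^`().[x]) *: q x.
have r0 : r = 0.
  apply: (@roots_geq_poly_eq0 _ r rs) => //; last first.
    rewrite /r (leq_trans (size_polyD _ _)) // geq_max szp size_polyN.
    apply: (leq_trans (size_sum _ _ _)); apply/bigmax_leqP_seq => x xrs _.
    rewrite (leq_trans (size_scale_leq _ _)) // size_divp ?polyXsubC_eq0 //.
    by rewrite size_XsubC /= leq_subLR add1n.
  apply/allP => x xrs; rewrite /root /r hornerD hornerN horner_sum.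
  rewrite (bigD1_seq x) //= big_seq_cond big1 => [|z /andP[zrs zx]].
    by rewrite addr0 hornerZ -Q'q // divfK ?subrr // Q'0.
  rewrite hornerZ; suff -> : (q z).[x] = 0 by rewrite mulr0.
  have := rootQ x xrs; rewrite /root {1}(Qq z zrs) hornerM hornerXsubC mulf_eq0.
  rewrite subr_eq0 (eq_sym x) (negPf zx) orbF => /eqP ->; by [].
have -> : p = \sum_(x <- rs) (p.[x] / Q^`().[x]) *: q x.
  by apply/eqP; rewrite -subr_eq0 -/r r0.
rewrite horner_sum mulr_sumr [RHS]big_seq [LHS]big_seq; apply: eq_bigr => x xrs.
have yx : y - x != 0 by rewrite subr_eq0; apply: contraNneq yrs => ->.
rewrite {2}(Qq x xrs) hornerZ hornerM hornerXsubC.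
have -> : (\sum_(z <- rs) (p.[z] / Q^`().[z]) *: q z).[x] = p.[x].
  rewrite -[in RHS](subrK (\sum_(x <- rs) (p.[x] / Q^`().[x]) *: q x) p).
  by rewrite -/r r0 add0r.
rewrite /=; by field; rewrite yx Q'0.
Qed.

Lemma deriv_prod_XsubC (F : fieldType) (rs : seq F) (x : F) : x \notin rs ->
  (\prod_(r <- rs) ('X - r%:P))^`().[x] =
  (\prod_(r <- rs) ('X - r%:P)).[x] * \sum_(r <- rs) (x - r)^-1.
Proof.
elim: rs => [|r rs IH]; first by rewrite !big_nil derivC horner0 mulr0.
rewrite inE negb_or -subr_eq0 => /andP[xr /IH {}IH].
rewrite !big_cons derivM derivXsubC !hornerE IH; by field.
Qed.

Section Selfreciprocal.
Variable C : numClosedFieldType.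
Implicit Types (z r : C) (p H : {poly C}).

(** The Blaschke factor inequality, from $|z - r|^2 - |1 - \bar z r|^2 = (1 - |z|^2)(|r|^2 - 1)$. *)
Lemma norm_sub_reflect z r : `|z| <= 1 -> 1 <= `|r| ->
  `|1 - z^* * r| <= `|z - r|.
Proof.
move=> z1 r1; rewrite -(@ler_pXn2r _ 2) ?nnegrE // -subr_ge0.
rewrite !normCK !rmorphB !rmorphM rmorph1 /= conjCK.
have -> : (z - r) * (z^* - r^*) - (1 - z^* * r) * (1 - z * r^*) =
  (1 - z * z^*) * (r * r^* - 1) by ring.
rewrite -!normCK mulr_ge0 // subr_ge0 ?expr_le1 ?exprn_ege1 //.
Qed.

Lemma horner_conj p z : p \is a polyOver Num.real -> p.[z^*] = (p.[z])^*.
Proof.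
move=> /polyOverP pR; rewrite -horner_map /=; congr horner.
apply/polyP => i; rewrite coef_map /=; apply/esym/CrealP.
by rewrite pR.
Qed.

(** This is $z^n p(1/z)$. Coefficients are reversed without conjugation, which for real coefficients
    agrees with the usual reciprocal polynomial. *)
Definition recip n p : {poly C} := \poly_(i < n.+1) p`_(n - i).

Lemma horner_recip n p z : (size p <= n.+1)%N -> z != 0 ->
  (recip n p).[z] = z ^+ n * p.[z^-1].
Proof.
move=> szp z0; rewrite horner_poly (horner_coef_wide _ szp) mulr_sumr.
rewrite (reindex_inj rev_ord_inj) /=; apply: eq_bigr => i _.
rewrite subSS subKn ?leq_ord // mulrCA; congr (_ * _).
by rewrite exprVn -exprB ?unitfE ?leq_ord.
Qed.

(** The operator $X\,d/dX$ multiplies the coefficient of index $i$ by $i = n - (n - i)$. *)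
Lemma deriv_recip n p : ('X * (recip n p)^`() = recip n (n%:R *: p - 'X * p^`())).
Proof.
apply/polyP => -[|i]; rewrite /recip coefXM [RHS]coef_poly /=.
  rewrite subn0 coefB coefZ coefXM; case: n => [|n] /=; first by rewrite mul0r subr0.
  by rewrite coef_deriv mulr_natl subrr.
rewrite coef_deriv coef_poly !ltnS; case: ltnP => // lt_in; last by rewrite mul0rn.
rewrite coefB coefZ coefXM subnS; case En : (n - i)%N => [|k] /=; first by lia.
case: k En => [|k] En /=; first by rewrite subr0 mulr_natl; congr (_ *+ _); lia.
rewrite coef_deriv mulr_natl -mulrnBr; last by lia.
by congr (_ *+ _); lia.
Qed.

End Selfreciprocal.

Section Palindrome.
Variables (C : numClosedFieldType) (H : {poly C}) (n : nat).
Implicit Type z : C.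
Hypothesis realH : H \is a polyOver Num.real.
Hypothesis szH : (size H <= n)%N.
Hypothesis H_neq0 : forall z, `|z| <= 1 -> H.[z] != 0.
Let Q : {poly C} := H + recip n H.

Let H0_neq0 : H`_0 != 0.
Proof. by rewrite -horner_coef0 H_neq0 // normr0. Qed.

Let H_poly_neq0 : H != 0.
Proof. by apply: contraNneq H0_neq0 => ->; rewrite coef0. Qed.

Lemma size_palindrome : size Q = n.+1.
Proof.
by rewrite /Q addrC size_polyDl size_poly_eq ?subnn ?ltnS.
Qed.

Lemma palindrome0 : Q.[0] = H.[0].
Proof.
rewrite /Q hornerD !horner_coef0 coef_poly subn0 /= (nth_default _ szH).
by rewrite addr0.
Qed.

Let Q_z z : z != 0 -> Q.[z] = H.[z] + z ^+ n * H.[z^-1].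
Proof. by move=> z0; rewrite hornerD horner_recip // (leq_trans szH). Qed.

Let roots_H : exists rs, [/\ H = lead_coef H *: \prod_(r <- rs) ('X - r%:P),
  size rs = (size H).-1 & {in rs, forall r, 1 < `|r|}].
Proof.
have [rs Hrs] := closed_field_poly_normal H; exists rs.
split=> // [|r rrs].
  by rewrite {1}Hrs size_scale ?lead_coef_eq0 // size_prod_XsubC.
rewrite real_ltNge ?normr_real ?real1 //; apply/negP => /H_neq0/negP; apply.
by rewrite -/(root H r) Hrs rootZ ?lead_coef_eq0 // root_prod_XsubC.
Qed.

(** In the open disc $z^n H(1/z)$ is strictly smaller in modulus than $H(z)$, so the two terms of
    $Q$ cannot cancel. The symmetry $Q(z) = z^n Q(1/z)$ carries this to the outside of the disc. *)
Lemma palindrome_root z : root Q z -> `|z| = 1.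
Proof.
have half w : root Q w -> 1 <= `|w|.
  move=> Qw; rewrite real_leNgt ?normr_real ?real1 //; apply/negP => w1.
  have w0 : w != 0.
    apply: contraTneq Qw => ->; rewrite /root palindrome0 horner_coef0.
    exact: H0_neq0.
  have [rs [Hrs szrs rs1]] := roots_H.
  have lt_rs : (size rs < n)%N.
    by rewrite szrs prednK // lt0n size_poly_eq0.
  (* Since $H$ is real, the left side is, up to the leading coefficient, the product of the $|1 -
     \bar w r|$ over the zeros $r$; compare factor by factor. *)
  have le : `|w| ^+ size rs * `|H.[w^-1]| <= `|H.[w]|.
    have -> : `|H.[w^-1]| = `|H.[(w^-1)^*]| by rewrite horner_conj // norm_conjC.
    rewrite Hrs !hornerZ !normrM mulrCA ler_wpM2l //.
    elim: (rs) rs1 => [|r s IH] s1; first by rewrite !big_nil !hornerC mul1r.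
    rewrite !big_cons !hornerM !normrM exprS mulrACA.
    rewrite ler_pM ?mulr_ge0 ?exprn_ge0 //; last first.
      by apply: IH => x xs; rewrite s1 // inE xs orbT.
    rewrite !hornerXsubC -{1}(norm_conjC w) -normrM mulrBr -rmorphM mulfV // rmorph1.
    by apply: norm_sub_reflect; rewrite ltW // s1 ?mem_head.
  move: Qw; rewrite /root Q_z // addr_eq0 => /eqP Hw.
  have Hw0 : 0 < `|H.[w]| by rewrite normr_gt0 H_neq0 // ltW.
  (* As $\deg H < n$, at least one power of $|w|$ is left over. *)
  have : `|H.[w]| <= `|w| * `|H.[w]|.
    rewrite {1}Hw normrN normrM normrX.
    have -> : n = (n - (size rs).+1 + (size rs).+1)%N by rewrite subnK.
    rewrite exprD exprS mulrCA -mulrA ler_wpM2l // -mulrA.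
    by apply: le_trans le; rewrite ler_piMl ?mulr_ge0 ?exprn_ge0 // exprn_ile1 // ltW.
  by rewrite ler_pMl // => /(lt_le_trans w1); rewrite ltxx.
move=> Qz; apply/eqP; rewrite eq_le half // andbT.
have z0 : z != 0.
  apply: contraTneq Qz => ->; rewrite /root palindrome0 horner_coef0.
  exact: H0_neq0.
rewrite -invf_ge1 ?normr_gt0 // -normfV half //.
move: Qz; rewrite /root !Q_z ?invr_eq0 // invrK => /eqP Hz.
have -> : H.[z^-1] + z^-1 ^+ n * H.[z] = z^-1 ^+ n * (H.[z] + z ^+ n * H.[z^-1]).
  by rewrite mulrDr mulrA -exprMn mulVf // expr1n mul1r addrC.
by rewrite Hz mulr0.
Qed.

(* At a root, z Q'(z) / H(z) = 2 Re (z H'(z) / H(z)) - n, and each zero r of H adds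
   Re (z / (z - r)) < 1/2 to the real part. *)
Lemma palindrome_weight_gt0 z : root Q z -> 0 < - H.[z] / (z * Q^`().[z]).
Proof.
move=> Qz; have z1 := palindrome_root Qz.
have z0 : z != 0 by rewrite -normr_gt0 z1 ltr01.
have Hz0 : H.[z] != 0 by rewrite H_neq0 // z1.
have zV : z^-1 = z^* by rewrite invC_norm z1 expr1n invr1 mul1r.
have [rs [Hrs szrs rs1]] := roots_H.
pose L := \sum_(r <- rs) z / (z - r).
have zH' : z * H^`().[z] = H.[z] * L.
  rewrite Hrs derivZ !hornerZ deriv_prod_XsubC; last first.
    by apply/negP => /rs1; rewrite z1 ltxx.
  by rewrite /L -mulr_sumr; ring.
have zQ' : z * Q^`().[z] = H.[z] * (L + L^* - n%:R).
  have -> : z * Q^`().[z] = ('X * Q^`()).[z] by rewrite hornerM hornerX.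
  rewrite derivD mulrDr deriv_recip hornerD hornerM hornerX zH'.
  rewrite horner_recip //; last first.
    rewrite (leq_trans (size_polyD _ _)) // geq_max size_polyN.
    rewrite (leq_trans (size_scale_leq _ _)) ?(leqW szH) //.
    rewrite (leq_trans (size_polyMleq _ _)) // size_polyX add2n /= leqW //.
    exact: leq_trans (lt_size_deriv H_poly_neq0) szH.
  rewrite zV horner_conj; last first.
    apply/polyOverP => i; rewrite coefB coefZ coefXM coef_deriv.
    move/polyOverP: realH => Hi; apply: realB; first by rewrite realM ?realn.
    by case: eqP => // _; rewrite -mulr_natl realM ?realn.
  rewrite !hornerE zH' !rmorphB !rmorphM /= rmorph_nat.
  (* At the root, $z^n \overline{H(z)} = - H(z)$, which lets $H(z)$ factor out. *)
  move: Qz; rewrite /root Q_z // zV horner_conj // addr_eq0 => /eqP Hz.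
  ring: Hz.
have L_lt : L + L^* < n%:R.
  apply: (@le_lt_trans _ _ (size rs)%:R); last first.
    by rewrite ltr_nat szrs prednK // lt0n size_poly_eq0.
  rewrite /L rmorph_sum -big_split /= -sum1_size natr_sum.
  rewrite [X in X <= _]big_seq [X in _ <= X]big_seq.
  apply: ler_sum => r /rs1 r1.
  have zr : z - r != 0 by rewrite subr_eq0; apply: contraTneq r1 => <-; rewrite z1 ltxx.
  have zr' : z^* - r^* != 0 by rewrite -rmorphB conjC_eq0.
  rewrite fmorph_div rmorphB /= -subr_ge0.
  have -> : 1 - (z / (z - r) + z^* / (z^* - r^*)) =
     (r * r^* - z * z^*) / ((z - r) * (z - r)^*).
    by rewrite rmorphB; field; rewrite zr zr'.
  rewrite -!normCK z1 expr1n divr_ge0 ?exprn_ge0 // subr_ge0 exprn_ege1 // ltW //.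
rewrite zQ' invfM mulNr mulrA divff // mul1r -invrN opprB.
by rewrite invr_gt0 subr_gt0.
Qed.
End Palindrome.

(** * Fejer kernels *)

Section Dot.
Variable C : numClosedFieldType.
Implicit Types p q : {poly C}.

(** By Parseval, the inner product of $L^2(d\theta / 2\pi)$ on the circle. *)
Definition dot p q : C := \sum_(i < size p) p`_i * (q`_i)^*.

Lemma dot_wide N p q : (size p <= N)%N -> dot p q = \sum_(i < N) p`_i * (q`_i)^*.
Proof.
move=> szp; rewrite /dot -!(big_mkord xpredT (fun i => p`_i * (q`_i)^*)).
rewrite [RHS](big_cat_nat (leq0n _) szp) /=.
rewrite [X in _ = _ + X]big_nat_cond [X in _ = _ + X]big1 ?addr0 // => i.
by move=> /andP[/andP[/(nth_default 0) ->]]; rewrite mul0r.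
Qed.

Lemma dot_norm N p : (size p <= N)%N -> dot p p = \sum_(i < N) `|p`_i| ^+ 2.
Proof. by move=> /dot_wide ->; apply: eq_bigr => i _; rewrite normCK. Qed.

Lemma dot_ge0 p : 0 <= dot p p.
Proof. by rewrite (dot_norm (leqnn _)) sumr_ge0 // => i _; rewrite exprn_ge0. Qed.

(** The difference of the two sides is $(da - cb)^2 / (cd)$. Summed over coefficients, this gives
    the triangle inequality for [dot] without square roots. *)
Lemma sqr_add_le (c d a b : C) : 0 < c -> 0 < d ->
  a \is Num.real -> b \is Num.real ->
  (a + b) ^+ 2 <= (c + d) / c * a ^+ 2 + (c + d) / d * b ^+ 2.
Proof.
move=> c0 d0 ra rb; rewrite -subr_ge0.
have -> : (c + d) / c * a ^+ 2 + (c + d) / d * b ^+ 2 - (a + b) ^+ 2 =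
    (d * a - c * b) ^+ 2 / (c * d).
  by field; rewrite !gt_eqF.
apply: divr_ge0; last by rewrite mulr_ge0 ?ltW.
by apply: real_exprn_even_ge0; rewrite // realB // realM // gtr0_real.
Qed.

Lemma dot_triangle p q (c d : C) : 0 < c -> 0 < d ->
  dot p p <= c ^+ 2 -> dot q q <= d ^+ 2 -> dot (p + q) (p + q) <= (c + d) ^+ 2.
Proof.
move=> c0 d0; pose N := maxn (size p) (size q).
rewrite (@dot_norm N p) ?leq_maxl // (@dot_norm N q) ?leq_maxr //.
rewrite (@dot_norm N) ?size_polyD // => pc qd.
apply: (@le_trans _ _ (\sum_(i < N)
    ((c + d) / c * `|p`_i| ^+ 2 + (c + d) / d * `|q`_i| ^+ 2))).
  apply: ler_sum => i _; apply: (@le_trans _ _ ((`|p`_i| + `|q`_i|) ^+ 2)).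
    by rewrite coefD lerXn2r ?nnegrE ?addr_ge0 // ler_normD.
  by apply: sqr_add_le; rewrite ?normr_real.
rewrite big_split -!mulr_sumr /=.
have -> : (c + d) ^+ 2 = (c + d) / c * c ^+ 2 + (c + d) / d * d ^+ 2.
  by field; rewrite !gt_eqF.
by rewrite lerD // ler_wpM2l // divr_ge0 ?addr_ge0 ?ltW.
Qed.

Lemma dotZ (a : C) p : dot (a *: p) (a *: p) = `|a| ^+ 2 * dot p p.
Proof.
rewrite (dot_norm (size_scale_leq _ _)) (dot_norm (leqnn _)) mulr_sumr.
by apply: eq_bigr => i _; rewrite coefZ normrM exprMn.
Qed.

Lemma dot_recip n p : (size p <= n.+1)%N -> dot (recip n p) (recip n p) = dot p p.
Proof.
move=> szp; rewrite (dot_norm szp) (dot_norm (size_poly _ _)).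
rewrite (reindex_inj rev_ord_inj) /=; apply: eq_bigr => i _.
rewrite coef_poly !subSS ltnS leq_subr subKn ?leq_ord //.
Qed.

End Dot.

Section Fejer.
Variable C : numClosedFieldType.
Implicit Types (z w : C).

(** $N$ times the classical Fejer kernel with its negative frequencies dropped. The constant term is
    kept whole, whence the extra $N$ in [fejer_kernel]. *)
Definition fejer N : {poly C} := \poly_(k < N) (N - k)%:R.

Lemma horner_fejerS N z : (fejer N.+1).[z] = (fejer N).[z] + \sum_(k < N.+1) z ^+ k.
Proof.
rewrite !horner_poly big_ord_recr [in RHS]big_ord_recr /= addrA -big_split /= subSnn mul1r.
congr (_ + _); apply: eq_bigr => i _.
rewrite subSn; last exact: ltnW (ltn_ord i).
by rewrite -[(N - i).+1]addn1 natrD mulrDl mul1r.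
Qed.

(* On the circle [w] is the conjugate of [z], and this says
   2 Re fejer N = N + |1 + z + ... + z^(N-1)|^2. *)
Lemma fejer_kernel N z w : z * w = 1 -> (fejer N).[z] + (fejer N).[w] =
  N%:R + (\sum_(k < N) z ^+ k) * (\sum_(k < N) w ^+ k).
Proof.
move=> zw; elim: N => [|N IH].
  by rewrite !horner_poly !big_ord0 mul0r.
rewrite !horner_fejerS addrACA IH.
(* With $y = 1/x$, multiplication by $y^N$ reverses the geometric sum into $y + \dots + y^N$. *)
have shift (x y : C) : x * y = 1 ->
    (\sum_(k < N) x ^+ k) * y ^+ N = \sum_(k < N.+1) y ^+ k - 1.
  move=> xy; rewrite big_ord_recl /= expr0 addrC addKr mulr_suml.
  rewrite (reindex_inj rev_ord_inj) /=; apply: eq_bigr => i _.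
  have -> : y ^+ N = y ^+ (N - i.+1) * y ^+ i.+1 by rewrite -exprD subnK.
  by rewrite mulrA -exprMn xy expr1n mul1r.
have wz : w * z = 1 by rewrite mulrC.
rewrite [in RHS]big_ord_recr [X in _ = _ + _ * X]big_ord_recr /=.
rewrite mulrDl !mulrDr shift // [X in _ = _ + (_ + (X + _))]mulrC shift //.
rewrite -exprMn zw expr1n.
rewrite -natr1; ring.
Qed.

Lemma fejer_Re_ge N z : `|z| = 1 -> N%:R / 2 <= 'Re (fejer N).[z].
Proof.
move=> z1; have zz : z * z^* = 1 by rewrite -normCK z1 expr1n.
rewrite ReE ler_pM2r ?invr_gt0 ?ltr0n // -horner_conj; last first.
  by apply/polyOverP => i; rewrite coef_poly; case: ifP => _; rewrite ?realn ?real0.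
rewrite fejer_kernel //.
have -> : \sum_(k < N) z^* ^+ k = (\sum_(k < N) z ^+ k)^*.
  by rewrite rmorph_sum; apply: eq_bigr => k _; rewrite rmorphXn.
by rewrite lerDl -normCK exprn_ge0.
Qed.

Lemma norm_1_subX k z : `|z| = 1 -> `|1 - z ^+ k| <= k%:R * `|1 - z|.
Proof.
move=> z1; elim: k => [|k IH]; first by rewrite expr0 subrr normr0 mul0r.
have -> : 1 - z ^+ k.+1 = (1 - z) + z * (1 - z ^+ k) by rewrite exprS; ring.
rewrite (le_trans (ler_normD _ _)) // normrM z1 mul1r -natr1 mulrDl mul1r addrC.
by rewrite lerD.
Qed.

Lemma sum_fejer_coef N : (\sum_(k < N) (N - k) * 2 = N * N.+1)%N.
Proof.
elim: N => [|N IH]; first by rewrite big_ord0.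
rewrite big_ord_recl subn0 /=.
under eq_bigr do rewrite /bump /= add1n subSS.
by rewrite IH; lia.
Qed.

Lemma fejer1 N : (fejer N).[1] * 2 = (N * N.+1)%:R.
Proof.
rewrite horner_poly mulr_suml -sum_fejer_coef natr_sum; apply: eq_bigr => k _.
by rewrite expr1n mulr1 natrM.
Qed.

(** Each power $z^k$ with $k < N$ is within distance 1 of 1, so its real part is at least $1/2$, and
    the coefficients add up to $N(N+1)/2$. *)
Lemma fejer_Re_near N z : `|z| = 1 -> N%:R * `|1 - z| <= 1 ->
  N%:R ^+ 2 / 4 <= 'Re (fejer N).[z].
Proof.
move=> z1 Nz.
have Re_ge (k : 'I_N) : 1 / 2 <= 'Re (z ^+ k).
  have : `|1 - z ^+ k| ^+ 2 <= 1.
    rewrite expr_le1 // (le_trans (norm_1_subX _ z1)) // (le_trans _ Nz) //.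
    by rewrite ler_wpM2r // ler_nat ltnW.
  rewrite normCK rmorphB rmorph1 /= mulrBl !mulrBr !mul1r !mulr1 -normCK.
  rewrite normrX z1 !expr1n.
  move=> le1; rewrite -subr_ge0 in le1; rewrite ReE -subr_ge0.
  have -> : (z ^+ k + (z ^+ k)^*) / 2 - 2^-1 =
      (1 - (1 - (z ^+ k)^* - (z ^+ k - 1))) / 2.
    by field.
  by rewrite divr_ge0 ?ler0n.
rewrite horner_poly raddf_sum /=.
apply: (@le_trans _ _ (\sum_(k < N) (N - k)%:R * (1 / 2))).
  rewrite -mulr_suml -natr_sum.
  have -> : (\sum_(k < N) (N - k))%:R * (1 / 2) = (N * N.+1)%:R / 4 :> C.
    by rewrite -sum_fejer_coef -big_distrl /= natrM; field.
  by rewrite ler_pM2r ?invr_gt0 ?ltr0n // -natrX ler_nat -mulnn leq_mul.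
apply: ler_sum => k _; rewrite ReMl ?realn // ler_wpM2l ?ler0n //.
Qed.

(** The factor $1 - z$ leaves $N$ minus $N$ powers of modulus at most $|z|$, which has positive real
    part in the open disc for $N \ge 1$. This is how $H$ is shown to have no zero there. *)
Lemma fejer_disc N z : (1 - z) * (fejer N).[z] = N%:R - \sum_(k < N) z ^+ k.+1.
Proof.
elim: N => [|N IH]; first by rewrite horner_poly !big_ord0 mulr0 subr0.
rewrite horner_fejerS mulrDr IH [in RHS]big_ord_recr /= -natr1.
have -> : (1 - z) * \sum_(k < N.+1) z ^+ k = 1 - z ^+ N.+1.
  by rewrite -opprB mulNr -subrX1 opprB.
by ring.
Qed.

End Fejer.

(** * Lacunary sums of Fejer kernels *)

Section Lacunary.
Variable C : numClosedFieldType.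
Implicit Types z : C.

(* On the arc |theta| <= 16^-j the j-th term is of the size of (256 / r)^j, so that
   Re (lac r J) behaves like |theta|^(-1/4) for r = 128 and |theta|^(-3/4) for r = 32,
   as long as |theta| >= 16^-J. *)
Definition lac r J : {poly C} := \sum_(j < J.+1) r%:R ^- j *: fejer C (16 ^ j).

Lemma lacS r J : lac r J.+1 = lac r J + r%:R ^- J.+1 *: fejer C (16 ^ J.+1).
Proof. by rewrite /lac big_ord_recr. Qed.

Lemma horner_lac r J z :
  (lac r J).[z] = \sum_(j < J.+1) r%:R ^- j * (fejer C (16 ^ j)).[z].
Proof. by rewrite horner_sum; apply: eq_bigr => j _; rewrite hornerZ. Qed.

Lemma coef_fejer_ge0 N i : 0 <= (fejer C N)`_i.
Proof. by rewrite coef_poly; case: ifP => _; rewrite ?ler0n. Qed.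

Lemma coef_lac_ge0 r J i : 0 <= (lac r J)`_i.
Proof.
rewrite coef_sum sumr_ge0 // => j _.
by rewrite coefZ mulr_ge0 ?coef_fejer_ge0 // invr_ge0 exprn_ge0 ?ler0n.
Qed.

Lemma size_lac r J : (size (lac r J) <= 16 ^ J)%N.
Proof.
apply: (leq_trans (size_sum _ _ _)); apply/bigmax_leqP => j _.
rewrite (leq_trans (size_scale_leq _ _)) // (leq_trans (size_poly _ _)) //.
by rewrite leq_exp2l // -ltnS.
Qed.

Lemma fejer_disc_Re_ge N z : `|z| <= 1 ->
  N%:R * (1 - `|z|) <= 'Re ((1 - z) * (fejer C N).[z]).
Proof.
move=> z1; rewrite fejer_disc raddfB /= (Creal_ReP _ _) ?realn //.
rewrite mulrBr mulr1 lerD // lerN2.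
apply: (@le_trans _ _ `|\sum_(k < N) z ^+ k.+1|).
  exact: (leif_Re_Creal _).1.
rewrite (le_trans (ler_norm_sum _ _ _)) //.
rewrite mulrC mulr_natr -[N in X in _ <= X]card_ord -sumr_const ler_sum // => k _.
by rewrite normrX exprS ler_piMr // exprn_ile1.
Qed.

Lemma lac_disc_Re_gt0 r J z : (0 < r)%N -> `|z| < 1 ->
  0 < 'Re ((1 - z) * (lac r J).[z]).
Proof.
move=> r0 z1.
have rj k : 0 <= r%:R ^- k :> C by rewrite invr_ge0 exprn_ge0 ?ler0n.
have rjR k : r%:R ^- k \is @Num.real C by rewrite ger0_real.
rewrite horner_lac mulr_sumr raddf_sum /= big_ord_recl /=.
rewrite ltr_wpDr //.
  apply: sumr_ge0 => i _; rewrite mulrCA ReMl // mulr_ge0 //.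
  rewrite (le_trans _ (fejer_disc_Re_ge _ (ltW z1))) //.
  by rewrite mulr_ge0 ?ler0n // subr_ge0 ltW.
rewrite expr0 invr1 mul1r (lt_le_trans _ (fejer_disc_Re_ge _ (ltW z1))) //.
by rewrite expn0 mul1r subr_gt0.
Qed.

(** The $j$-th term alone gives the bound; on the circle all the others have nonnegative real
    part. *)
Lemma lac_Re_ge r J j z : (0 < r)%N -> `|z| = 1 -> (j <= J)%N ->
  (16 ^ j)%:R * `|1 - z| <= 1 ->
  r%:R ^- j * ((16 ^ j)%:R ^+ 2 / 4) <= 'Re (lac r J).[z].
Proof.
move=> r0 z1 jJ near.
have rj k : 0 <= r%:R ^- k :> C by rewrite invr_ge0 exprn_ge0 ?ler0n.
have rjR k : r%:R ^- k \is @Num.real C by rewrite ger0_real.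
rewrite horner_lac raddf_sum /= (bigD1 (Ordinal (jJ : (j < J.+1)%N))) //=.
rewrite ReMl // -[X in X <= _]addr0 lerD //.
  by rewrite ler_wpM2l // fejer_Re_near.
rewrite sumr_ge0 // => i _; rewrite ReMl // mulr_ge0 //.
by rewrite (le_trans _ (fejer_Re_ge _ z1)) // divr_ge0 ?ler0n.
Qed.

Lemma lac_Re_ge_half r J z : (0 < r)%N -> `|z| = 1 -> 2^-1 <= 'Re (lac r J).[z].
Proof.
move=> r0 z1.
have rj k : 0 <= r%:R ^- k :> C by rewrite invr_ge0 exprn_ge0 ?ler0n.
have rjR k : r%:R ^- k \is @Num.real C by rewrite ger0_real.
rewrite horner_lac raddf_sum /= big_ord_recl /= -[X in X <= _]addr0 lerD //.
  rewrite expr0 invr1 mul1r; have := @fejer_Re_ge C (16 ^ 0) _ z1.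
  by rewrite expn0 mul1r.
rewrite sumr_ge0 // => i _; rewrite ReMl // mulr_ge0 //.
by rewrite (le_trans _ (fejer_Re_ge _ z1)) // divr_ge0 ?ler0n.
Qed.

Lemma fejer1_le N : (fejer C N).[1] <= N%:R ^+ 2.
Proof.
rewrite -(ler_pM2r (_ : 0 < 2)) // fejer1 -natrX -natrM ler_nat.
by case: N => // N; nia.
Qed.

(** The $j$-th term is at most $16^{2j} / 128^j = 2^j$, so at 1 the tail stays below the order $4^J$
    of the peak. *)
Lemma lac_1_le J : (lac 128 J).[1] <= 2 * 2 ^+ J.
Proof.
elim: J => [|J IH].
  rewrite horner_lac big_ord1 !expr0 invr1 mul1r mulr1.
  rewrite horner_poly big_ord1 expr0 mulr1 subn0.
  by rewrite ler_nat.
rewrite lacS hornerD hornerZ.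
have -> : 2 * 2 ^+ J.+1 = 2 * 2 ^+ J + 2 * 2 ^+ J :> C by rewrite exprS; ring.
rewrite lerD //.
have -> : 2 * 2 ^+ J = 128%:R ^- J.+1 * (16 ^ J.+1)%:R ^+ 2 :> C.
  rewrite natrX exprAC -exprVn -exprMn (_ : 128%:R^-1 * _ = 2) ?exprS //.
  by field.
rewrite ler_wpM2l ?invr_ge0 ?exprn_ge0 ?ler0n //.
exact: fejer1_le.
Qed.

Lemma fejer_dot N (a : C) :
  dot (a *: fejer C N) (a *: fejer C N) <= `|a| ^+ 2 * N%:R ^+ 3.
Proof.
rewrite dotZ ler_wpM2l ?exprn_ge0 // (dot_norm (size_poly _ _)).
have -> : N%:R ^+ 3 = \sum_(k < N) N%:R ^+ 2 :> C.
  by rewrite sumr_const card_ord exprSr mulr_natr.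
rewrite ler_sum // => k _.
by rewrite coef_poly ltn_ord normr_nat -!natrX ler_nat leq_exp2r // leq_subr.
Qed.

(** A Fejer polynomial of order $N$ has norm at most $N^{3/2}$, so the $j$-th term has norm at most
    $64^j / 128^j = 2^{-j}$. *)
Lemma lac_dot J : dot (lac 128 J) (lac 128 J) <= (2 - 2 ^- J) ^+ 2.
Proof.
elim: J => [|J IH].
  have -> : 2 - 2 ^- 0 = 1 :> C by rewrite expr0 invr1; ring.
  rewrite /lac big_ord1 (le_trans (fejer_dot _ _)) // !expr0 invr1 normr1 expn0 !expr1n.
  by rewrite mul1r.
have -> : 2 - 2 ^- J.+1 = (2 - 2 ^- J) + 2 ^- J.+1 :> C.
  by rewrite exprS invfM; field; rewrite expf_eq0 pnatr_eq0 andbF.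
have pow1 : 2 ^- J <= 1 :> C by rewrite invf_le1 ?exprn_gt0 // exprn_ege1 // ler1n.
have gt0 : 0 < 2 - 2 ^- J :> C by rewrite subr_gt0 (le_lt_trans pow1) // ltr1n.
have gt0' : 0 < 2 ^- J.+1 :> C by rewrite invr_gt0 exprn_gt0.
rewrite lacS; apply: dot_triangle => //.
rewrite (le_trans (fejer_dot _ _)) // ger0_norm ?invr_ge0 ?exprn_ge0 // natrX.
rewrite -!exprVn (exprAC 128^-1) (exprAC 16) (exprAC 2^-1) -exprMn.
by rewrite (_ : _ * _ = 2^-1 ^+ 2) //; field.
Qed.

Lemma lac32_0_bounds J : 1 <= (lac 32 J).[0] <= 2 - 2 ^- J.
Proof.
have f0 N : (fejer C N.+1).[0] = N.+1%:R by rewrite horner_coef0 coef_poly subn0.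
elim: J => [|J /andP[IH1 IH2]].
  have -> : 2 - 2 ^- 0 = 1 :> C by rewrite expr0 invr1; ring.
  by rewrite horner_lac big_ord1 !expr0 invr1 mul1r f0 lexx.
rewrite lacS hornerD hornerZ.
have -> : 32%:R ^- J.+1 * (fejer C (16 ^ J.+1)).[0] = 2 ^- J.+1.
  rewrite -(prednK (_ : 0 < 16 ^ J.+1)%N) ?expn_gt0 // f0 prednK ?expn_gt0 //.
  by rewrite natrX -exprVn -exprMn (_ : 32%:R^-1 * _ = 2^-1) ?exprVn //; field.
rewrite (le_trans IH1) ?lerDl ?invr_ge0 ?exprn_ge0 //=.
rewrite (le_trans (lerD IH2 (lexx _))) //.
rewrite exprS invfM le_eqVlt; apply/orP; left; apply/eqP; field.
by rewrite expf_eq0 pnatr_eq0 andbF.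
Qed.

(** Take the largest $j \le J$ with $16^j y \le 1$. If $j < J$ then $16^{j+1} y > 1$; the factor 32
    instead of 16 covers $j = J$. *)
Lemma dyadic_scale J (y : C) : 0 <= y <= 1 -> 1 <= 32 * (16 ^ J)%:R * y ->
  exists2 j, (j <= J)%N & (16 ^ j)%:R * y <= 1 <= 32 * (16 ^ j)%:R * y.
Proof.
move=> /andP[y0 y1]; elim: J => [|J IH] yJ.
  by exists 0%N; rewrite // mul1r y1.
have yR : (16 ^ J.+1)%:R * y \is Num.real by rewrite realM ?realn // ger0_real.
have [le1|gt1] := real_leP yR (@real1 C).
- by exists J.+1; rewrite // le1.
have [|j jJ Hj] := IH; last by exists j; rewrite // (leq_trans jJ).
rewrite (le_trans (ltW gt1)) // expnS natrM -mulrA -[X in _ <= X]mulrA.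
by rewrite ler_wpM2r ?mulr_ge0 ?ler0n // ler_nat.
Qed.

End Lacunary.

(** * The nodes *)

Section Nodes.
Variable C : numClosedFieldType.
Implicit Types z : C.

(** Nonnegative coefficients give $Q(1) = |Q(1) - Q(z)| \le \sum_i Q_i |1 - z^i| \le n |1 - z|
    Q(1)$. *)
Lemma root_away_from_1 (Q : {poly C}) n z : (forall i, 0 <= Q`_i) -> 0 < Q.[1] ->
  (size Q <= n.+1)%N -> `|z| = 1 -> root Q z -> 1 <= n%:R * `|1 - z|.
Proof.
move=> Q0 Q1 szQ z1 /eqP Qz.
have H1 : Q.[1] = \sum_(i < n.+1) Q`_i.
  by rewrite (horner_coef_wide _ szQ); apply: eq_bigr => i _; rewrite expr1n mulr1.
rewrite -(ler_pM2l Q1) mulr1 -{1}(ger0_norm (ltW Q1)) -[X in `|X|]subr0 -Qz.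
rewrite {1}H1 (horner_coef_wide _ szQ) -sumrB (le_trans (ler_norm_sum _ _ _)) //.
rewrite H1 mulr_suml ler_sum // => i _.
rewrite -{1}[Q`_i]mulr1 -mulrBr normrM ger0_norm // ler_wpM2l //.
rewrite (le_trans (norm_1_subX _ z1)) // ler_wpM2r // ler_nat -ltnS //.
Qed.

Lemma uniq_roots_deriv_neq0 (Q : {poly C}) rs :
  Q = lead_coef Q *: \prod_(r <- rs) ('X - r%:P) ->
  lead_coef Q != 0 -> {in rs, forall x, Q^`().[x] != 0} -> uniq rs.
Proof.
move=> QE Q0 Q'; rewrite -separable_prod_XsubC separable_poly.unlock.
apply: Pdiv.ClosedField.root_coprimep => x; rewrite root_prod_XsubC => /Q'.
by rewrite QE derivZ hornerZ mulf_eq0 negb_or => /andP[].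
Qed.

Section Scale.
Variables n J : nat.
Hypothesis leJ : (2 * 16 ^ J <= n.+1)%N.
Hypothesis ltJ : (n.+1 < 32 * 16 ^ J)%N.

(** The first summand is the tail, the second the peak. The factor $64^{-J}$ brings the norm of the
    peak down to at most $(16^J)^{3/2} / 64^J = 1$ and leaves a height of about $4^J / 2$ at 1. *)
Let H : {poly C} := lac C 128 J + 64 ^- J *: fejer C (16 ^ J).
Let V : {poly C} := lac C 32 J.
Let Q : {poly C} := H + recip n H.
Let weight z : C := - H.[z] / (z * Q^`().[z]).
Let mass z : C := weight z * 'Re V.[z] / V.[0].
Let s : C := 4 ^+ J.

Let pow64_ge0 : 0 <= 64 ^- J :> C.
Proof. by rewrite invr_ge0 exprn_ge0 // ler0n. Qed.

Let H_ge0 i : 0 <= H`_i.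
Proof.
by rewrite coefD addr_ge0 ?coef_lac_ge0 // coefZ mulr_ge0 ?coef_fejer_ge0.
Qed.

Let szH : (size H <= 16 ^ J)%N.
Proof.
rewrite (leq_trans (size_polyD _ _)) // geq_max size_lac.
by rewrite (leq_trans (size_scale_leq _ _)) // size_poly.
Qed.

Let szHn : (size H <= n)%N.
Proof. by apply: leq_trans szH _; lia. Qed.

Let H_Re_gt z : `|z| = 1 -> 'Re (lac C 128 J).[z] <= 'Re H.[z].
Proof.
move=> z1; rewrite hornerD raddfD /= lerDl hornerZ ReMl ?ger0_real //.
by rewrite mulr_ge0 // (le_trans _ (fejer_Re_ge _ z1)) // divr_ge0 ?ler0n.
Qed.

Let H_neq0 z : `|z| <= 1 -> H.[z] != 0.
Proof.
rewrite le_eqVlt => /orP[/eqP z1|z1]; apply/eqP => Hz.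
  have := le_trans (lac_Re_ge_half J (isT : (0 < 128)%N) z1) (H_Re_gt z1).
  by rewrite Hz raddf0 lt_geF ?invr_gt0 ?ltr0n.
have : 0 < 'Re ((1 - z) * H.[z]); last by rewrite Hz mulr0 raddf0 ltxx.
rewrite hornerD mulrDr raddfD /= ltr_wpDr ?lac_disc_Re_gt0 //.
rewrite hornerZ mulrCA ReMl ?ger0_real // mulr_ge0 //.
rewrite (le_trans _ (fejer_disc_Re_ge _ (ltW z1))) //.
by rewrite mulr_ge0 ?ler0n // subr_ge0 ltW.
Qed.

Let realH : H \is a polyOver Num.real.
Proof. by apply/polyOverP => i; rewrite ger0_real. Qed.

Let Q_ge0 i : 0 <= Q`_i.
Proof. by rewrite coefD addr_ge0 // coef_poly; case: ifP. Qed.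

Let Q1 : Q.[1] = 2 * H.[1].
Proof.
rewrite hornerD horner_recip ?oner_neq0 // ?(leq_trans szHn) //.
by rewrite expr1n invr1 mul1r mulr_natl.
Qed.

Let pow4 : 64 ^- J * (16 ^ J)%:R = 4 ^- J :> C.
Proof. by rewrite natrX -!exprVn -exprMn; congr (_ ^+ _); field. Qed.

Let s_le_Q1 : s <= Q.[1].
Proof.
rewrite Q1 hornerD mulrDr ler_wpDl //.
  rewrite mulr_ge0 // horner_coef sumr_ge0 // => i _.
  by rewrite expr1n mulr1 coef_lac_ge0.
rewrite hornerZ mulrCA [2 * _]mulrC fejer1 natrM mulrA pow4.
rewrite -ler_pdivrMl ?invr_gt0 ?exprn_gt0 // invrK /s -exprMn -natrM -natrX ler_nat.
by rewrite (_ : 4 * 4 = 16)%N.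
Qed.

Let Q1_le : Q.[1] <= 6 * s.
Proof.
rewrite Q1 hornerD.
have le24 : (2 ^+ J : C) <= s by rewrite /s lerXn2r ?nnegrE ?ler_nat ?ler0n.
have -> : 6 * s = 2 * (2 * s + s) by ring.
rewrite ler_wpM2l // lerD //.
  by rewrite (le_trans (lac_1_le C J)) // ler_wpM2l.
rewrite hornerZ (le_trans (ler_wpM2l _ (fejer1_le _ _))) //.
by rewrite expr2 mulrA pow4 natrX -exprVn -exprMn /s (_ : 4^-1 * _ = 4) //; field.
Qed.

(** Norm at most 2 for the tail and 1 for the peak, hence 3 for $H$ and for its reversal, and 6 for
    $Q$. *)
Let Q_dot : dot Q Q <= 36.
Proof.
have dH : dot H H <= 3 ^+ 2.
  have -> : 3 = 2 + 1 :> C by ring.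
  apply: dot_triangle; rewrite ?ltr0n ?ltr01 //.
    apply: le_trans (lac_dot C J) _; rewrite lerXn2r ?nnegrE //; last first.
      by rewrite gerBl invr_ge0 exprn_ge0.
    rewrite subr_ge0; apply: (@le_trans _ _ 1); last by rewrite ler1n.
    by rewrite invf_le1 ?exprn_gt0 ?ltr0n // exprn_ege1 // ler1n.
  rewrite (le_trans (fejer_dot _ _)) // ger0_norm // natrX -exprVn.
  by rewrite (exprAC 64^-1) (exprAC 16) -exprMn (_ : _ * _ = 1) ?expr1n //; field.
have -> : 36 = (3 + 3) ^+ 2 :> C by ring.
by apply: dot_triangle; rewrite ?dot_recip ?ltr0n // (leq_trans szHn).
Qed.

(** At distance about $16^{-j}$ from 1, the real parts of $H$ and $V$ are at least $2^j / 4$ and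
    $8^j / 4$. Their product $16^j / 16$ makes up for $|1 - z| \ge 1 / (32 \cdot 16^j)$; this is
    where the exponents $1/4$ and $3/4$ add up to 1. *)
Let lower z : `|z| = 1 -> 1 <= n%:R * `|1 - z| ->
  1 / 512 <= `|1 - z| * `|H.[z]| * 'Re V.[z].
Proof.
move=> z1; pose y : C := `|1 - z|; rewrite -[`|1 - z|]/y => zn.
have y0 : 0 <= y := normr_ge0 _.
have r128 : (0 < 128)%N by []. have r32 : (0 < 32)%N by [].
have HV t u : 0 <= t -> 0 <= u -> t <= 'Re (lac C 128 J).[z] -> u <= 'Re V.[z] ->
    y * (t * u) <= y * `|H.[z]| * 'Re V.[z].
  move=> t0 u0 Ht Vu; rewrite -mulrA ler_wpM2l // ler_pM // (le_trans Ht) //.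
  by rewrite (le_trans (H_Re_gt z1)) // (leif_Re_Creal _).1.
have [y1|y1] := real_leP (normr_real (1 - z)) (@real1 C); last first.
  apply: le_trans (HV _ _ _ _ (lac_Re_ge_half _ r128 z1) (lac_Re_ge_half _ r32 z1)).
  all: rewrite ?invr_ge0 //.
  apply: (@le_trans _ _ (1 * (2^-1 * 2^-1))); last first.
    by rewrite ler_wpM2r ?mulr_ge0 ?invr_ge0 // ltW.
  by rewrite !mul1r -invfM lef_pV2 ?posrE ?mulr_gt0 ?ltr0n // -natrM ler_nat.
have [||j jJ /andP[near far]] := @dyadic_scale C J y.
- by rewrite y0.
- by rewrite (le_trans zn) // ler_wpM2r // -natrM ler_nat; lia.
apply: le_trans (HV _ _ _ _ (lac_Re_ge r128 z1 jJ near) (lac_Re_ge r32 z1 jJ near)).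
all: rewrite ?mulr_ge0 ?divr_ge0 ?invr_ge0 ?exprn_ge0 //.
have -> : 128 ^- j * ((16 ^ j)%:R ^+ 2 / 4) * (32 ^- j * ((16 ^ j)%:R ^+ 2 / 4)) =
    (16 ^ j)%:R / 16 :> C.
  have E (a b c : C) : a * b * (c ^+ 2 / 4 * (c ^+ 2 / 4)) =
      a * b * c ^+ 4 / 16 by field.
  rewrite mulrACA E natrX (exprAC 16) -!exprVn -!exprMn.
  by congr (_ ^+ _ / _); field.
have -> : y * ((16 ^ j)%:R / 16) = 32 * (16 ^ j)%:R * y / 512 by field.
by rewrite ler_pM2r ?invr_gt0 ?ltr0n.
Qed.

(** Interpolation at the zeros gives $|R(1)| \le \sum_x |Q(1)| |R(x)| / (|Q'(x)| |1 - x|)$. Here $1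
    / |Q'(x)|$ is the quadrature weight over $|H(x)|$, and [lower] trades $1 / (|H(x)| |1 - x|)$ for
    a multiple of the real part of $V(x)$. *)
Lemma steklov_nodes : exists rs : seq C, exists m : C -> C, exists Q : {poly C},
  [/\ {in rs, forall x, `|x| = 1 /\ 0 < m x}, \sum_(x <- rs) m x = 1,
      size Q = n.+1 /\ all (root Q) rs, dot Q Q <= 36 & s <= `|Q.[1]| /\
      forall R : {poly C}, (size R <= n)%N ->
        `|R.[1]| <= 6144 * s * \sum_(x <- rs) m x * `|R.[x]|].
Proof.
have szQ : size Q = n.+1 by apply: size_palindrome.
have Q0 : Q != 0 by rewrite -size_poly_eq0 szQ.
have [rs QE] := closed_field_poly_normal Q.
have szrs : size rs = n.
  by apply/succn_inj; rewrite -szQ QE size_scale ?lead_coef_eq0 // size_prod_XsubC.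
have rootE x : x \in rs = root Q x by rewrite QE rootZ ?lead_coef_eq0 // root_prod_XsubC.
have rs1 x : x \in rs -> `|x| = 1 by rewrite rootE; apply: palindrome_root.
have w_gt0 x : x \in rs -> 0 < weight x by rewrite rootE; apply: palindrome_weight_gt0.
have Q' : {in rs, forall x, Q^`().[x] != 0}.
  move=> x /w_gt0; rewrite /weight; apply: contraTneq => ->.
  by rewrite mulr0 invr0 mulr0 ltxx.
have Q1_gt0 : 0 < Q.[1] by rewrite (lt_le_trans _ s_le_Q1) // exprn_gt0.
have lQ : lead_coef Q != 0 by rewrite lead_coef_eq0.
have Urs := uniq_roots_deriv_neq0 QE lQ Q'.
have rootQ : all (root Q) rs by apply/allP => x; rewrite rootE.
have szQrs : (size Q <= (size rs).+1)%N by rewrite szQ szrs.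
have x_neq0 x : x \in rs -> x != 0.
  by move=> /rs1 x1; rewrite -normr_gt0 x1.
have H0 : H.[0] != 0 by rewrite H_neq0 // normr0.
have V0 : 0 < V.[0] by case/andP: (lac32_0_bounds C J) => /(lt_le_trans ltr01).
have V0le : V.[0] <= 2.
  by case/andP: (lac32_0_bounds C J) => _ /le_trans; apply; rewrite gerBl invr_ge0 exprn_ge0.
(* Interpolation of H * V at 0: the weights integrate V exactly. *)
have wV : \sum_(x <- rs) weight x * V.[x] = V.[0].
  have szHV : (size (H * V)%R <= size rs)%N.
    rewrite szrs (leq_trans (size_polyMleq _ _)) //.
    have aux (a b k m : nat) :
        (a <= k -> b <= k -> 2 * k <= m.+1 -> (a + b).-1 <= m)%N.
      by clear; lia.
    exact: aux szH (size_lac C 32 J) leJ.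
  have r0 : 0 \notin rs by apply/negP => /x_neq0; rewrite eqxx.
  have := lagrange_eval Urs rootQ Q' szQrs szHV r0.
  rewrite hornerM palindrome0 // => /(mulfI H0) ->.
  rewrite !big_seq; apply: eq_bigr => x xrs.
  by rewrite hornerM sub0r mulrN invrN mulrN /weight [x * _]mulrC; ring.
exists rs, mass, Q; split=> //.
- move=> x xrs; split; first exact: rs1.
  rewrite /mass divr_gt0 // mulr_gt0 ?w_gt0 //.
  have Re_ge := lac_Re_ge_half J (isT : (0 < 32)%N) (rs1 x xrs).
  by rewrite (lt_le_trans _ Re_ge) // invr_gt0.
(* The weights are real, so the exact formula for $V$ passes to real parts and the masses add up to
   1. *)
- rewrite /mass -mulr_suml -[X in X / _](_ : 'Re V.[0] = _).
    by rewrite (Creal_ReP _ _) ?divff ?gt_eqF // gtr0_real.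
  rewrite -wV raddf_sum /= !big_seq; apply: eq_bigr => x /w_gt0 w0.
  by rewrite ReMl // gtr0_real.
split=> [|R szR]; first by rewrite ger0_norm // ltW.
have r1 : 1 \notin rs.
  by rewrite rootE /root gt_eqF.
rewrite (lagrange_eval Urs rootQ Q' szQrs _ r1) ?szrs //.
rewrite mulr_sumr (le_trans (ler_norm_sum _ _ _)) // mulr_sumr.
rewrite !big_seq; apply: ler_sum => x xrs.
have x1 := rs1 x xrs.
have Hx : 0 < `|H.[x]| by rewrite normr_gt0 H_neq0 // x1.
have Q'x : `|Q^`().[x]|^-1 = weight x / `|H.[x]|.
  rewrite -{1}(ger0_norm (ltW (w_gt0 x xrs))) /weight normrM normrN.
  rewrite normfV normrM x1 mul1r.
  by field; rewrite ?normr_eq0 Q' // -normr_eq0 gt_eqF.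
have y0 : 0 < `|1 - x| by rewrite normr_gt0 subr_eq0; apply: contraNneq r1 => ->.
have low : 1 <= 512%:R * (`|1 - x| * `|H.[x]| * 'Re V.[x]).
  rewrite -ler_pdivrMl ?ltr0n // mulr1 -[_^-1]mul1r lower ?x1 //.
  apply: (root_away_from_1 Q_ge0 Q1_gt0) => //; first by rewrite szQ.
  by rewrite -rootE.
(* $6144 = 6 \cdot 512 \cdot 2$: the bound $Q(1) \le 6s$, the constant of [lower], and $V(0) \le
   2$. *)
have key : Q.[1] <= 6144 * s * ('Re V.[x] / V.[0]) * (`|H.[x]| * `|1 - x|).
  have -> : 6144 * s * ('Re V.[x] / V.[0]) * (`|H.[x]| * `|1 - x|) =
    6 * s * (512%:R * (`|1 - x| * `|H.[x]| * 'Re V.[x]) * (2 / V.[0])).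
    by field; rewrite gt_eqF.
  rewrite (le_trans Q1_le) // ler_peMr ?mulr_ge0 ?exprn_ge0 // mulr_ege1 //.
  by rewrite ler_pdivlMr // mul1r.
rewrite !normrM normfV normrM invfM Q'x (ger0_norm (ltW Q1_gt0)) /mass.
rewrite -ler_pdivrMr ?mulr_gt0 // in key.
have -> : Q.[1] * (`|R.[x]| * (weight x / `|H.[x]| / `|1 - x|)) =
  weight x * `|R.[x]| * (Q.[1] / (`|H.[x]| * `|1 - x|)).
  by field; rewrite !gt_eqF.
have -> : 6144 * s * (weight x * 'Re V.[x] / V.[0] * `|R.[x]|) =
  weight x * `|R.[x]| * (6144 * s * ('Re V.[x] / V.[0])).
  by field; rewrite gt_eqF.
by rewrite ler_wpM2l // mulr_ge0 // ltW // w_gt0.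
Qed.
End Scale.
End Nodes.

(** * Orthonormal polynomials *)

Section InnerProduct.
Variables (C : numClosedFieldType) (a : C) (rs : seq C) (m : C -> C).
Hypothesis a_gt0 : 0 < a.
Hypothesis m_ge0 : {in rs, forall x, 0 <= m x}.
Implicit Types p q : {poly C}.

(** The inner product of the measure $a\,d\theta / 2\pi + \sum_x m_x \delta_x$; [cintegral_ip]
    identifies it with the integral. *)
Definition ip p q : C := a * dot p q + \sum_(x <- rs) m x * (p.[x] * (q.[x])^*).

Lemma ipDl p1 p2 q : ip (p1 + p2) q = ip p1 q + ip p2 q.
Proof.
pose N := maxn (size p1) (size p2).
rewrite /ip (@dot_wide _ N (p1 + p2)) ?size_polyD //.
rewrite (@dot_wide _ N p1) ?leq_maxl // (@dot_wide _ N p2) ?leq_maxr //.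
rewrite addrACA -mulrDr -!big_split /=; congr (_ * _ + _).
  by apply: eq_bigr => i _; rewrite coefD mulrDl.
by apply: eq_bigr => x _; rewrite hornerD mulrDl mulrDr.
Qed.

Lemma ipZl c p q : ip (c *: p) q = c * ip p q.
Proof.
rewrite /ip (@dot_wide _ (size p) (c *: p)) ?size_scale_leq // /dot.
rewrite mulrDr mulrCA !mulr_sumr; congr (_ + _).
  by apply: eq_bigr => i _; rewrite coefZ; ring.
by apply: eq_bigr => x _; rewrite hornerZ; ring.
Qed.

Lemma ipC p q : ip q p = (ip p q)^*.
Proof.
pose N := maxn (size p) (size q).
rewrite /ip (@dot_wide _ N p) ?leq_maxl // (@dot_wide _ N q) ?leq_maxr //.
rewrite rmorphD rmorphM !rmorph_sum /= (conj_Creal (gtr0_real a_gt0)).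
congr (_ * _ + _).
  by apply: eq_bigr => i _; rewrite rmorphM /= conjCK mulrC.
rewrite !big_seq; apply: eq_bigr => x /m_ge0 m0.
by rewrite !rmorphM /= conjCK (conj_Creal (ger0_real m0)); ring.
Qed.

Lemma ipBl p1 p2 q : ip (p1 - p2) q = ip p1 q - ip p2 q.
Proof. by rewrite -scaleN1r ipDl ipZl mulN1r. Qed.

Lemma ipDr p q1 q2 : ip p (q1 + q2) = ip p q1 + ip p q2.
Proof. by rewrite ipC ipDl rmorphD /= -!ipC. Qed.

Lemma ipBr p q1 q2 : ip p (q1 - q2) = ip p q1 - ip p q2.
Proof. by rewrite ipC ipBl rmorphB /= -!ipC. Qed.

Lemma ip0l q : ip 0 q = 0.
Proof. by rewrite -(scale0r 0) ipZl mul0r. Qed.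

Lemma ipZr c p q : ip p (c *: q) = c^* * ip p q.
Proof. by rewrite ipC ipZl rmorphM /= -ipC. Qed.

Lemma ip_ge_dot p : a * dot p p <= ip p p.
Proof.
rewrite lerDl big_seq sumr_ge0 // => x /m_ge0 m0.
by rewrite -normCK mulr_ge0 ?exprn_ge0.
Qed.

Lemma ip_gt0 p : p != 0 -> 0 < ip p p.
Proof.
move=> p0; apply: lt_le_trans (ip_ge_dot p); rewrite mulr_gt0 //.
have sz0 : (0 < size p)%N by rewrite lt0n size_poly_eq0.
rewrite (dot_norm (leqnn _)).
rewrite (bigD1 (Ordinal (_ : (size p).-1 < size p)%N)) ?prednK //= => ?.
apply: ltr_wpDr; first by rewrite sumr_ge0 // => i _; rewrite exprn_ge0.
by rewrite exprn_gt0 // normr_gt0 -lead_coefE lead_coef_eq0.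
Qed.

(** Gram-Schmidt by induction: [u], which is $X^n$ minus its own projection, is orthogonal to all
    smaller degrees, and adding the component of $p$ along [u] extends the projection by one
    degree. *)
Lemma projection n p : exists2 q : {poly C}, (size q <= n)%N &
  forall r : {poly C}, (size r <= n)%N -> ip r (p - q) = 0.
Proof.
elim: n p => [|n IH] p.
  exists 0; rewrite ?size_poly0 // => r; rewrite leqn0 size_poly_eq0 => /eqP ->.
  exact: ip0l.
have [u0 szu0 u0P] := IH 'X^n; pose u := 'X^n - u0.
have szu : size u = n.+1.
  by rewrite size_polyDl ?size_polyXn // size_polyN ltnS.
have uu : 0 < ip u u by rewrite ip_gt0 // -size_poly_eq0 szu.
have [q szq qP] := IH p; exists (q + (ip p u / ip u u) *: u).
  rewrite (leq_trans (size_polyD _ _)) // geq_max leqW //=.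
  by rewrite (leq_trans (size_scale_leq _ _)) // szu.
move=> r szr; pose v := r - r`_n *: u.
have szv : (size v <= n)%N.
  apply/leq_sizeP => j; rewrite leq_eqVlt => /predU1P[<-|nj].
    rewrite /v /u coefB coefZ coefB coefXn eqxx (nth_default 0 szu0).
    by rewrite subr0 mulr1 subrr.
  rewrite coefB coefZ (nth_default 0 (leq_trans szr nj)) (@nth_default _ 0 u) ?szu //.
  by rewrite mulr0 subr0.
have -> : r = v + r`_n *: u by rewrite subrK.
have uq : ip u q = 0 by rewrite ipC u0P // rmorph0.
have vpq : ip v (p - q) = 0 by exact: qP.
have vu : ip v u = 0 by exact: u0P.
rewrite opprD addrA ipDl ipZl !(ipBr _ (p - q)) vpq !ipZr vu (ipBr u p q) uq subr0.
by rewrite mulr0 subr0 add0r fmorph_div /= -!ipC divfK ?gt_eqF // subrr mulr0.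
Qed.

Lemma orthonormal_exists : exists phi : nat -> {poly C},
  [/\ forall n, size (phi n) = n.+1 /\ 0 < lead_coef (phi n),
      forall n k, ip (phi n) (phi k) = (n == k)%:R &
      forall n p, (size p <= n)%N -> ip p (phi n) = 0].
Proof.
pose monic_ok n (q : {poly C}) := (size q <= n)%N /\
  forall r : {poly C}, (size r <= n)%N -> ip r ('X^n - q) = 0.
have ex n : exists q, monic_ok n q by have [q szq qP] := projection n 'X^n; exists q.
have [q qP] := choice ex.
pose u n := 'X^n - q n.
have szu n : size (u n) = n.+1.
  by rewrite size_polyDl ?size_polyXn // size_polyN ltnS; case: (qP n).
have lu n : lead_coef (u n) = 1.
  by rewrite lead_coefDl ?lead_coefXn // size_polyXn size_polyN ltnS; case: (qP n).
have uu n : 0 < ip (u n) (u n) by rewrite ip_gt0 // -size_poly_eq0 szu.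
pose c n := (sqrtC (ip (u n) (u n)))^-1.
have c0 n : 0 < c n by rewrite invr_gt0 sqrtC_gt0.
have ortho n p : (size p <= n)%N -> ip p (c n *: u n) = 0.
  by move=> szp; rewrite ipZr (proj2 (qP n)) ?mulr0.
have szphi n : size (c n *: u n) = n.+1 by rewrite size_scale ?gt_eqF.
exists (fun n => c n *: u n); split=> // [n|n k].
  by rewrite lead_coefZ lu mulr1.
case: (ltngtP n k) => [nk|kn|->].
- by rewrite ortho // szphi.
- by rewrite ipC ortho ?rmorph0 // szphi.
rewrite ipZl ipZr (conj_Creal (gtr0_real (c0 k))) mulrA -expr2 exprVn sqrtCK.
by rewrite mulVf // gt_eqF.
Qed.

End InnerProduct.

(* 6144 * 4^J * 9 t bounds the lower-degree part of Q at 1; the hypothesis on t makes this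
   at most half of 4^J <= |Q(1)|. *)
Lemma orthonormal_large (C : numClosedFieldType) (n J : nat) (t : C) :
  (2 * 16 ^ J <= n.+1)%N -> (n.+1 < 32 * 16 ^ J)%N ->
  0 < t -> 6144 * 18 * t <= 1 ->
  exists rs : seq C, exists m : C -> C, exists phi : nat -> {poly C},
  [/\ {in rs, forall x, `|x| = 1 /\ 0 < m x}, \sum_(x <- rs) m x = 1 - t ^+ 2,
    forall k, size (phi k) = k.+1 /\ 0 < lead_coef (phi k),
    forall k l, ip (t ^+ 2) rs m (phi k) (phi l) = (k == l)%:R &
    4 ^+ J <= 12 * t * `|(phi n).[1]|].
Proof.
move=> leJ ltJ t0 t1.
have [rs [m [Q [rsP mE [szQ rootQ] dotQ [Q1 lebQ]]]]] := steklov_nodes C leJ ltJ.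
have t2 : 2 * t <= 1.
  by rewrite (le_trans _ t1) // ler_wpM2r ?(ltW t0) // -natrM ler_nat.
have tt2 : t ^+ 2 <= 2^-1.
  have tle1 : t <= 1 by rewrite (le_trans _ t2) // ler_peMl ?(ltW t0) // ler1n.
  rewrite -[2^-1]mulr1 ler_pdivlMl // expr2 mulrA (le_trans _ t2) //.
  by rewrite ler_piMr // mulr_ge0 // ltW.
have tt0 : 0 < t ^+ 2 by rewrite exprn_gt0.
pose d := 1 - t ^+ 2.
have d2 : 2^-1 <= d.
  by rewrite /d lerBrDr addrC -lerBrDr (_ : 1 - 2^-1 = 2^-1) //; field.
have d0 : 0 < d by apply: lt_le_trans d2; rewrite invr_gt0.
(* The density takes up mass $t^2$, so the atoms are scaled to total $1 - t^2$. *)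
pose dm x := d * m x.
have dm_ge0 : {in rs, forall x, 0 <= dm x}.
  by move=> x /rsP[_ m0]; rewrite mulr_ge0 // ltW.
have [phi [szphi ortho lowphi]] := orthonormal_exists tt0 dm_ge0.
exists rs, dm, phi; split=> //.
- by move=> x /rsP[x1 m0]; split; rewrite // mulr_gt0.
- by rewrite -mulr_sumr mE mulr1.
pose b := lead_coef Q / lead_coef (phi n).
have lphi : lead_coef (phi n) != 0 by rewrite gt_eqF //; case: (szphi n).
pose R := Q - b *: phi n.
have szR : (size R <= n)%N.
  apply/leq_sizeP => j; rewrite leq_eqVlt => /predU1P[<-|nj]; rewrite /R coefB coefZ.
    have -> : Q`_n = lead_coef Q by rewrite lead_coefE szQ.
    have -> : (phi n)`_n = lead_coef (phi n) by rewrite lead_coefE (szphi n).1.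
    by rewrite divfK // subrr.
  by rewrite !nth_default ?mulr0 ?subr0 ?szQ ?(szphi n).1.
have QE : Q = R + b *: phi n by rewrite subrK.
clearbody R.
(* Pythagoras: $R$ has degree below $n$, hence is orthogonal to $\phi_n$. *)
have RR : ip (t ^+ 2) rs dm Q Q = ip (t ^+ 2) rs dm R R + `|b| ^+ 2.
  have Rphi := lowphi n R szR.
  have phiR : ip (t ^+ 2) rs dm (phi n) R = 0 by rewrite (ipC tt0 dm_ge0) Rphi rmorph0.
  rewrite QE ipDl ipZl !(ipDr tt0 dm_ge0) !(ipZr tt0 dm_ge0) Rphi phiR ortho eqxx.
  by rewrite !mulr0 addr0 add0r mulr1 normCK.
(* $Q$ vanishes at every atom, so only the density sees it. *)
have QQ : ip (t ^+ 2) rs dm Q Q <= (6 * t) ^+ 2.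
  rewrite /ip big_seq big1 ?addr0 => [|x xrs].
    by rewrite exprMn mulrC -natrX ler_wpM2r // ltW.
  by have /eqP -> := allP rootQ x xrs; rewrite mul0r mulr0.
have b_le : `|b| <= 6 * t.
  rewrite -(@ler_pXn2r _ 2) ?nnegrE ?mulr_ge0 ?(ltW t0) //.
  rewrite (le_trans _ QQ) // RR lerDr (le_trans _ (ip_ge_dot _ dm_ge0 _)) //.
  by rewrite mulr_ge0 ?dot_ge0 // ltW.
(* Dividing by $d \ge 1/2$ gives $72 t^2$, rounded up to the square $81 t^2$. *)
have RR_le : \sum_(x <- rs) m x * `|R.[x]| ^+ 2 <= (9 * t) ^+ 2.
  have : d * \sum_(x <- rs) m x * `|R.[x]| ^+ 2 <= (6 * t) ^+ 2.
    rewrite (le_trans _ QQ) // RR.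
    rewrite (@le_trans _ _ (ip (t ^+ 2) rs dm R R)) ?lerDl ?exprn_ge0 //.
    rewrite /ip mulr_sumr (eq_bigr (fun x => dm x * (R.[x] * (R.[x])^*))) => [|x _].
      by rewrite lerDr mulr_ge0 ?dot_ge0 // ltW.
    by rewrite normCK /dm !mulrA.
  rewrite -ler_pdivlMl // => /le_trans; apply.
  have -> : (9 * t) ^+ 2 = 81%:R * t ^+ 2 by ring.
  have -> : d^-1 * (6 * t) ^+ 2 = (36%:R / d) * t ^+ 2 by ring.
  rewrite ler_wpM2r ?(ltW tt0) // ler_pdivrMr // (@le_trans _ _ (81%:R * 2^-1)) //.
    by rewrite ler_pdivlMr // -natrM ler_nat.
  by rewrite ler_wpM2l.
(* Cauchy-Schwarz for the probability weights [m], through $2 \cdot 9t\,|R(x)| \le (9t)^2 +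
   |R(x)|^2$. *)
have R_le : \sum_(x <- rs) m x * `|R.[x]| <= 9 * t.
  have t9 : 0 < 9 * t by rewrite mulr_gt0.
  rewrite -(ler_pM2l (_ : 0 < 2 * (9 * t))) ?mulr_gt0 // mulr_sumr.
  have -> : 2 * (9 * t) * (9 * t) = (9 * t) ^+ 2 + (9 * t) ^+ 2 by ring.
  have E : (9 * t) ^+ 2 = \sum_(x <- rs) m x * (9 * t) ^+ 2.
    by rewrite -mulr_suml mE mul1r.
  apply: le_trans (lerD RR_le (lexx _)); rewrite [X in _ <= _ + X]E -big_split.
  rewrite !big_seq; apply: ler_sum => x /rsP[_ m0] /=.
  rewrite -mulrDr mulrCA ler_wpM2l ?(ltW m0) // addrC -subr_ge0.
  have -> : (9 * t) ^+ 2 + `|R.[x]| ^+ 2 - 2 * (9 * t) * `|R.[x]| =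
      (9 * t - `|R.[x]|) ^+ 2 by ring.
  by apply: real_exprn_even_ge0; rewrite // realB ?normr_real // gtr0_real.
have R1 : `|R.[1]| <= 4 ^+ J / 2.
  have K0 : 0 <= 6144 * 4 ^+ J :> C by rewrite -natrX -natrM ler0n.
  have s0 : 0 <= 4 ^+ J / 2 :> C by rewrite divr_ge0 ?exprn_ge0 ?ler0n.
  apply: le_trans (lebQ R szR) _; apply: le_trans (ler_wpM2l K0 R_le) _.
  have -> : 6144 * 4 ^+ J * (9 * t) = 4 ^+ J / 2 * (6144 * 18 * t) by field.
  exact: ler_piMr.
clear t1 lebQ.
have : 4 ^+ J <= `|R.[1]| + `|b| * `|(phi n).[1]|.
  by rewrite (le_trans Q1) // QE hornerD hornerZ -normrM ler_normD.
move=> /le_trans/(_ (lerD R1 (ler_wpM2r (normr_ge0 _) b_le))).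
rewrite -lerBlDl (_ : 4 ^+ J - 4 ^+ J / 2 = 4 ^+ J / 2); last by field.
rewrite ler_pdivrMr // => /le_trans; apply.
by rewrite (_ : 12 * t * _ = 6 * t * `|(phi n).[1]| * 2) //; ring.
Qed.

(** * Measures on the circle *)

Section Atoms.
Variable R : realType.
Local Notation T := (measurableTypeR R).
Local Notation leb := (@lebesgue_measure R).
Implicit Types (f : R -> R) (mu : {measure set T -> \bar R}).

(** Bounded everywhere, not just almost everywhere, so that one condition gives integrability for
    the density and the atoms alike. *)
Definition tame f :=
  measurable_fun [set: T] (f : T -> R) /\ exists K : R, forall x, `|f x| <= K.

Lemma tame_integrable mu f : (mu (angles R) < +oo)%E -> tame f ->
  mu.-integrable (angles R) (EFin \o f).
Proof.
move=> mu_fin [mf [K fK]]; apply: measurable_bounded_integrable => //.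
- exact: measurable_angles.
- exact: measurable_funTS.
- exists K; split; rewrite ?num_real // => r Kr x _ /=.
  exact: le_trans (fK x) (ltW Kr).
Qed.

Lemma lebesgue_angles : leb (angles R) = (2 * pi)%:E.
Proof.
rewrite /angles lebesgue_measure_itv /= lte_fin gtrN ?pi_gt0 // -EFinB opprK.
by rewrite mulr_natl mulr2n.
Qed.

Lemma integral_mscale d (X : measurableType d) (m : {measure set X -> \bar R})
  (k : {nonneg R}) (D : set X) (f : X -> \bar R) : measurable D -> m.-integrable D f ->
  (\int[mscale k m]_(x in D) f x = k%:num%:E * \int[m]_(x in D) f x)%E.
Proof.
move=> mD intf; have mf := measurable_int _ intf.
rewrite (integralE (mscale k m)) (integralE m).
rewrite !ge0_integral_mscale //; last 2 first.
- exact: measurable_funeneg.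
- exact: measurable_funepos.
have pf := integrable_pos_fin_num mD intf; have nf := integrable_neg_fin_num mD intf.
by apply/esym; apply: muleBr => //; exact: fin_num_adde_defr.
Qed.

(** Atoms are added one at a time. Finiteness of the mass is carried along because it keeps bounded
    functions integrable, which splitting the integral over a sum of measures requires. *)
Lemma atomic_measure (c : R) (L : seq (R * R)) : 0 <= c ->
  (forall p, p \in L -> 0 <= p.1 /\ angles R p.2) ->
  exists mu, (mu [set: T] < +oo)%E /\ 
   (forall A, measurable A ->
     mu A = (c%:E * leb (A `&` angles R) + \sum_(p <- L) p.1%:E * \d_(p.2) A)%E) /\
   (forall f, tame f -> \int[mu]_(x in angles R) f x =
     c * (\int[leb]_(x in angles R) f x) + \sum_(p <- L) p.1 * f p.2).
Proof.
move=> c0; elim: L => [|[w th] L IH] HL.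
  pose mu := [the measure _ _ of mscale (NngNum c0) (mrestr leb (@measurable_angles R))].
  have muE A : mu A = (c%:E * leb (A `&` angles R))%E by [].
  have lebr : (mrestr leb (@measurable_angles R) (angles R) < +oo)%E.
    by rewrite /mrestr setIid lebesgue_angles ltry.
  exists mu; split; last split.
  - by rewrite muE setTI lebesgue_angles ltry.
  - by move=> A mA; rewrite muE big_nil adde0.
  - move=> f tf; rewrite big_nil addr0 /Rintegral.
    rewrite integral_mscale; last exact: tame_integrable.
      rewrite /= fineM //.
      + congr (_ * fine _); apply: eq_measure_integral => A mA Asub.
        by rewrite /= /mrestr setIidl.
      + apply: integrable_fin_num; last exact: tame_integrable.
        exact: measurable_angles.
    exact: measurable_angles.
have [|mu [mu_fin [muE mu_int]]] := IH.
  by move=> p pL; apply: HL; rewrite inE pL orbT.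
have [w0 th0] : 0 <= w /\ angles R th by apply: (HL (w, th)); rewrite mem_head.
pose at_th := [the measure _ _ of mscale (NngNum w0) (@dirac _ T th R)].
pose nu := [the measure _ _ of measure_add mu at_th].
have nuE A : nu A = (mu A + w%:E * \d_th A)%E by exact: measure_addE.
exists nu; split; last split.
- by rewrite nuE diracT mule1 lte_add_pinfty // ltry.
- move=> A mA; rewrite nuE muE // big_cons -addeA.
  by congr (_ + _)%E; rewrite addeC.
- move=> f tf; rewrite big_cons addrCA -mu_int //.
  have mA := @measurable_angles R.
  have dfin : ((@dirac _ T th R) (angles R) < +oo)%E.
    by rewrite diracE; case: (_ \in _); rewrite ltry.
  have mufin' : (mu (angles R) < +oo)%E.
    by apply: le_lt_trans mu_fin; apply: le_measure; rewrite ?inE.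
  have afin : (at_th (angles R) < +oo)%E.
    by rewrite /at_th /= /mscale /= diracE; case: (_ \in _); rewrite ltry.
  have int1 := tame_integrable mufin' tf.
  have int2 := tame_integrable afin tf.
  have int3 := tame_integrable dfin tf.
  have mf : measurable_fun (angles R) (EFin \o f) by exact: measurable_int int1.
  rewrite /Rintegral integral_measure_add //.
  rewrite fineD; try exact: integrable_fin_num.
  rewrite addrC; congr (_ + _).
  rewrite /at_th /= integral_mscale // integral_dirac // diracE mem_set // mul1e.
  by rewrite -EFinM.
Qed.
End Atoms.

(** * Trigonometric integrals over a period *)

Section Trig.
Variable R : realType.
Local Notation leb := (@lebesgue_measure R).

Lemma sin_natpi (n : nat) : sin (n%:R * pi) = 0 :> R.
Proof.
elim: n => [|n IH]; first by rewrite mul0r sin0.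
by rewrite -natr1 mulrDl mul1r sinDpi IH oppr0.
Qed.

Lemma Rintegral_angles_FTC (F f : R -> R) :
  (forall x : R, is_derive x (1 : R) F (f x)) -> continuous f -> F pi = F (- pi) ->
  \int[leb]_(x in angles R) f x = 0.
Proof.
move=> dF cf Fpi.
have cF x : {for x, continuous F}.
  by apply: differentiable_continuous; apply/derivable1_diffP; case: (dF x).
have pi2 : - pi < pi :> R by rewrite gtrN ?pi_gt0.
rewrite /angles Rintegral_itv_bndo_bndc; last first.
  have mI : measurable (`[- pi, pi]%classic : set (measurableTypeR R)).
    by exact: measurable_itv.
  apply: (integrableS mI); first exact: measurable_itv.
    by apply: subset_itvl; rewrite bnd_simp.
  apply: continuous_compact_integrable; first exact: segment_compact.
  exact: continuous_subspaceT.
rewrite /Rintegral (continuous_FTC2 pi2 (F := F)) //.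
- by rewrite Fpi -EFinB subrr.
- exact: continuous_subspaceT.
- split.
  + by move=> x _; case: (dF x).
  + exact: cvg_at_right_filter (cF _).
  + exact: cvg_at_left_filter (cF _).
- by move=> x _; rewrite derive1E; exact: derive_val.
Qed.

Lemma Rintegral_cos (k : R) : k != 0 -> sin (k * pi) = 0 ->
  \int[leb]_(x in angles R) cos (k * x) = 0.
Proof.
move=> k0 sk; apply: (@Rintegral_angles_FTC (fun x => k^-1 * sin (k * x))).
- move=> x; apply: is_derive_eq.
  by rewrite /GRing.scale /=; field.
- by move=> x; apply: continuous_comp; [exact: mulrl_continuous|exact: continuous_cos].
- by rewrite mulrN sinN sk oppr0.
Qed.

Lemma Rintegral_sin (k : R) : k != 0 ->
  \int[leb]_(x in angles R) sin (k * x) = 0.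
Proof.
move=> k0; apply: (@Rintegral_angles_FTC (fun x => - (k^-1 * cos (k * x)))).
- move=> x; apply: is_derive_eq.
  by rewrite /GRing.scale /=; field.
- by move=> x; apply: continuous_comp; [exact: mulrl_continuous|exact: continuous_sin].
- by rewrite mulrN cosN.
Qed.
End Trig.

Section Circle.
Variable R : realType.
Implicit Types (x y : R) (f g : R -> R[i]).

Lemma conjcE (z : R[i]) : z^* = conjc z.
Proof. by []. Qed.

Lemma cisD x y : cis (x + y) = cis x * cis y.
Proof.
rewrite /cis cosD sinD; apply/eqP.
by rewrite eq_complex /= [sin x * _ + _]addrC !eqxx.
Qed.

Lemma conjc_cis x : conjc (cis x) = cis (- x).
Proof. by rewrite /cis cosN sinN. Qed.

Lemma cisX x n : cis x ^+ n = cis (n%:R * x).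
Proof.
elim: n => [|n IH]; first by rewrite mul0r /cis cos0 sin0.
by rewrite exprS IH -natr1 mulrDl mul1r addrC cisD.
Qed.

Lemma cis_surj (z : R[i]) : `|z| = 1 -> exists2 theta, angles R theta & cis theta = z.
Proof.
case: z => a b; rewrite normc_def /= => -[] /(congr1 (fun x => x ^+ 2)).
rewrite sqr_sqrtr ?addr_ge0 ?sqr_ge0 // expr1n => ab.
have a1 : -1 <= a <= 1.
  rewrite -ler_norml -(@ler_pXn2r _ 2) ?nnegrE // expr1n.
  by rewrite real_normK ?num_real // -ab lerDl sqr_ge0.
have aI : a \in `[-1, 1] by rewrite in_itv.
have sE : Num.sqrt (1 - a ^+ 2) = `|b| by rewrite -ab addrC addKr sqrtr_sqr.
have acos0 := acos_ge0 a1; have acospi := acos_lepi a1.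
have [b0|b0] := leP 0 b.
  (* For $z = -1$ the arccosine is $\pi$, which the half-open period excludes; $-\pi$ replaces
     it. *)
  have [api|api] := eqVneq (acos a) pi.
    exists (- pi); first by rewrite /angles /= in_itv /= lexx gtrN // pi_gt0.
    rewrite /cis cosN sinN sinpi oppr0.
    have aN : a = -1 by rewrite -(acosK aI) api cospi.
    have b00 : b = 0.
      by apply/eqP; rewrite -sqrf_eq0 -(addKr (a ^+ 2) (b ^+ 2)) ab aN sqrrN expr1n addNr.
    by rewrite b00 aN cospi.
  exists (acos a).
    rewrite /angles /= in_itv /= lt_neqAle api acospi.
    by rewrite (le_trans _ acos0) // oppr_le0 pi_ge0.
  by rewrite /cis acosK // sin_acos // sE ger0_norm.
exists (- acos a).
  rewrite /angles /= in_itv /= lerN2 acospi /=.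
  by rewrite (le_lt_trans _ (pi_gt0 R)) // oppr_le0.
by rewrite /cis cosN sinN acosK // sin_acos // sE ltr0_norm // opprK.
Qed.

Definition ctame f := tame (@complex.Re R \o f) /\ tame (@complex.Im R \o f).

Lemma tameD (u v : R -> R) : tame u -> tame v -> tame (u \+ v).
Proof.
move=> [mu [K uK]] [mv [L vL]]; split; first exact: measurable_funD.
by exists (K + L) => x; rewrite (le_trans (ler_normD _ _)) // lerD.
Qed.

Lemma tameM (u v : R -> R) : tame u -> tame v -> tame (u \* v).
Proof.
move=> [mu [K uK]] [mv [L vL]]; split; first exact: measurable_funM.
by exists (K * L) => x; rewrite normrM ler_pM.
Qed.

Lemma tame_cst (c : R) : tame (cst c).
Proof. by split; [exact: measurable_cst | exists `|c|]. Qed.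

Lemma tameN (u : R -> R) : tame u -> tame (\- u).
Proof.
by move=> [mu [K uK]]; split; [exact: measurableT_comp | exists K => x; rewrite normrN].
Qed.

Lemma tame_cos (k : R) : tame (fun x => cos (k * x)).
Proof.
split; last by exists 1 => x; exact: cos_max.
apply: continuous_measurable_fun => x.
by apply: continuous_comp; [exact: mulrl_continuous|exact: continuous_cos].
Qed.

Lemma tame_sin (k : R) : tame (fun x => sin (k * x)).
Proof.
split; last by exists 1 => x; exact: sin_max.
apply: continuous_measurable_fun => x.
by apply: continuous_comp; [exact: mulrl_continuous|exact: continuous_sin].
Qed.

Lemma ctameD f g : ctame f -> ctame g -> ctame (f \+ g).
Proof.
move=> [fr fi] [gr gi]; split.
- by rewrite (_ : _ \o _ = (@complex.Re R \o f) \+ (@complex.Re R \o g)); [exact: tameD|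
    apply/funext => x /=; case: (f x) (g x) => ? ? []].
- by rewrite (_ : _ \o _ = (@complex.Im R \o f) \+ (@complex.Im R \o g)); [exact: tameD|
    apply/funext => x /=; case: (f x) (g x) => ? ? []].
Qed.

Lemma ctameZ (c : R[i]) f : ctame f -> ctame (fun x => c * f x).
Proof.
case: c => a b [fr fi]; split.
- rewrite (_ : _ \o _ =
      (cst a \* (@complex.Re R \o f)) \+ (\- (cst b \* (@complex.Im R \o f)))).
    by apply: tameD; [|apply: tameN]; apply: tameM => //; exact: tame_cst.
  by apply/funext => x /=; case: (f x).
- rewrite (_ : _ \o _ =
      (cst a \* (@complex.Im R \o f)) \+ (cst b \* (@complex.Re R \o f))).
    by apply: tameD; apply: tameM => //; exact: tame_cst.
  by apply/funext => x /=; case: (f x) => u v /=; rewrite addrC.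
Qed.

Lemma ctame_sum I (s : seq I) (F : I -> R -> R[i]) :
  (forall i, ctame (F i)) -> ctame (fun x => \sum_(i <- s) F i x).
Proof.
move=> tF; elim: s => [|i s IH].
  under eq_fun do rewrite big_nil; by split; exact: tame_cst.
by under eq_fun do rewrite big_cons; exact: ctameD.
Qed.

Section Integral.
Variable sigma : probability (measurableTypeR R) R.

Let fin : (sigma (angles R) < +oo)%E.
Proof.
by rewrite (le_lt_trans (probability_le1 _ _)) ?ltry //; exact: measurable_angles.
Qed.

Lemma cintegralD f g : ctame f -> ctame g ->
  cintegral sigma (fun x => f x + g x) = cintegral sigma f + cintegral sigma g.
Proof.
move=> [fr fi] [gr gi]; have mA := @measurable_angles R.
apply/eqP; rewrite /cintegral eq_complex /=; apply/andP; split; apply/eqP.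
- rewrite -RintegralD //; try exact: tame_integrable.
  by apply: eq_Rintegral => x _ /=; case: (f x) (g x) => ? ? [].
- rewrite -RintegralD //; try exact: tame_integrable.
  by apply: eq_Rintegral => x _ /=; case: (f x) (g x) => ? ? [].
Qed.

Lemma cintegralZ c f : ctame f ->
  cintegral sigma (fun x => c * f x) = c * cintegral sigma f.
Proof.
case: c => a b [fr fi]; have mA := @measurable_angles R.
have ir := tame_integrable fin fr; have ii := tame_integrable fin fi.
apply/eqP; rewrite /cintegral eq_complex /=; apply/andP; split; apply/eqP.
- rewrite -!RintegralZl // -RintegralB //;
    try exact: (tame_integrable fin (tameM (tame_cst _) _)).
  by apply: eq_Rintegral => x _ /=; case: (f x).
- rewrite -!RintegralZl // -RintegralD //;
    try exact: (tame_integrable fin (tameM (tame_cst _) _)).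
  by apply: eq_Rintegral => x _ /=; case: (f x).
Qed.

Lemma cintegral_sum I (s : seq I) (F : I -> R -> R[i]) : (forall i, ctame (F i)) ->
  cintegral sigma (fun x => \sum_(i <- s) F i x) = \sum_(i <- s) cintegral sigma (F i).
Proof.
move=> tF; elim: s => [|i s IH].
  have t0 : ctame (fun=> 0) by split; exact: tame_cst.
  transitivity (0 * cintegral sigma (fun=> 0)); last by rewrite big_nil mul0r.
  rewrite -cintegralZ //.
  by congr cintegral; apply/funext => x; rewrite big_nil mul0r.
rewrite big_cons -IH -cintegralD //; last exact: ctame_sum.
by congr cintegral; apply/funext => x; rewrite big_cons.
Qed.
End Integral.
End Circle.

Section Gram.
Variable R : realType.
Local Notation leb := (@lebesgue_measure R).

Lemma Rintegral_cos_nat (i j : nat) :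
  \int[leb]_(x in angles R) cos ((i%:R - j%:R) * x) = 2 * pi * (i == j)%:R.
Proof.
have [->|ij] := eqVneq i j.
  under eq_Rintegral do rewrite subrr mul0r cos0.
  rewrite Rintegral_cst; last exact: measurable_angles.
  by rewrite [X in fine X](lebesgue_angles R) mul1r mulr1.
rewrite mulr0 Rintegral_cos ?subr_eq0 ?eqr_nat //.
by rewrite mulrBl sinB !sin_natpi !(mul0r, mulr0) subrr.
Qed.

Lemma Rintegral_sin_nat (i j : nat) :
  \int[leb]_(x in angles R) sin ((i%:R - j%:R) * x) = 0.
Proof.
have [->|ij] := eqVneq i j; last by rewrite Rintegral_sin ?subr_eq0 ?eqr_nat.
under eq_Rintegral do rewrite subrr mul0r sin0.
by rewrite Rintegral_cst ?mul0r //; exact: measurable_angles.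
Qed.

Variables (sigma : probability (measurableTypeR R) R) (delta : R).
Variables (rs : seq R[i]) (m : R[i] -> R[i]) (ang : R[i] -> R).
Hypothesis angP : {in rs, forall x, cis (ang x) = x}.
Hypothesis m_ge0 : {in rs, forall x, 0 <= m x}.
Hypothesis sigmaE : forall f : R -> R, tame f -> \int[sigma]_(x in angles R) f x =
  delta / (2 * pi) * (\int[leb]_(x in angles R) f x) +
  \sum_(x <- rs) complex.Re (m x) * f (ang x).

Let term (i j : nat) (z : R[i]) := z ^+ i * conjc (z ^+ j).

Let term_cis i j x : term i j (cis x) = cis ((i%:R - j%:R) * x).
Proof. by rewrite /term !cisX conjc_cis -cisD -mulNr -mulrDl. Qed.

Let ctame_term i j : ctame (fun x => term i j (cis x)).
Proof.
under eq_fun do rewrite term_cis.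
by split; [exact: tame_cos | exact: tame_sin].
Qed.

Let cintegral_term i j : cintegral sigma (fun x => term i j (cis x)) =
  delta%:C%C * (i == j)%:R + \sum_(x <- rs) m x * term i j x.
Proof.
under eq_fun do rewrite term_cis.
rewrite /cintegral (sigmaE (tame_cos _)) (sigmaE (tame_sin _)).
rewrite Rintegral_cos_nat Rintegral_sin_nat mulr0 add0r.
have pi0 : pi != 0 :> R by rewrite gt_eqF // pi_gt0.
have -> : delta / (2 * pi) * (2 * pi * (i == j)%:R) = delta * (i == j)%:R.
  by rewrite mulrA divfK // mulf_neq0 // pnatr_eq0.
have mterm x : x \in rs -> m x * term i j x = Complex
    (complex.Re (m x) * cos ((i%:R - j%:R) * ang x))
    (complex.Re (m x) * sin ((i%:R - j%:R) * ang x)).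
  move=> xrs; have -> : term i j x = cis ((i%:R - j%:R) * ang x).
    by rewrite -term_cis angP.
  have := m_ge0 xrs; rewrite lecE /= => /andP[/eqP + _].
  case: (m x) => a b /= ->; rewrite /cis; apply/eqP; rewrite eq_complex /=.
  by rewrite !mul0r subr0 addr0 !eqxx.
have -> : \sum_(x <- rs) m x * term i j x = Complex
    (\sum_(x <- rs) complex.Re (m x) * cos ((i%:R - j%:R) * ang x))
    (\sum_(x <- rs) complex.Re (m x) * sin ((i%:R - j%:R) * ang x)).
  apply/eqP; rewrite eq_complex /= !raddf_sum /= !big_seq.
  by apply/andP; split; apply/eqP; apply: eq_bigr => x /mterm ->.
by apply/eqP; case: (i == j); rewrite ?(mulr0, mulr1) eq_complex /= ?add0r !eqxx.
Qed.

(** Expanded into the terms $z^i \bar z^j$, the density contributes $\delta$ on the diagonal only,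
    by orthogonality of the characters, and each atom contributes a point value. *)
Lemma cintegral_ip (p q : {poly R[i]}) :
  cintegral sigma (fun x => p.[cis x] * conjc q.[cis x]) = ip delta%:C%C rs m p q.
Proof.
pose N := maxn (size p) (size q).
have pq z : p.[z] * conjc q.[z] =
    \sum_(i < N) \sum_(j < N) (p`_i * (q`_j)^*) * term i j z.
  rewrite (@horner_coef_wide _ N p) ?leq_maxl // (@horner_coef_wide _ N q) ?leq_maxr //.
  rewrite -conjcE rmorph_sum mulr_suml; apply: eq_bigr => i _.
  rewrite mulr_sumr; apply: eq_bigr => j _.
  by rewrite rmorphM /= /term conjcE; ring.
under eq_fun do rewrite pq.
rewrite cintegral_sum => [|i]; last by apply: ctame_sum => j; exact: ctameZ.
rewrite /ip (@dot_wide _ N p) ?leq_maxl // mulr_sumr.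
transitivity (\sum_(i < N) (delta%:C%C * (p`_i * (q`_i)^*) +
   \sum_(x <- rs) m x * \sum_(j < N) p`_i * (q`_j)^* * term i j x)).
  apply: eq_bigr => i _; rewrite cintegral_sum => [|j]; last exact: ctameZ.
  under eq_bigr => j _ do rewrite cintegralZ // cintegral_term mulrDr mulr_sumr.
  rewrite big_split /= exchange_big /=; congr (_ + _).
    rewrite (bigD1 i) //= eqxx mulr1 big1 => [|j ji]; first by rewrite addr0 mulrC.
    by rewrite (negPf (_ : (i : nat) != j)) ?mulr0 // eq_sym.
  apply: eq_bigr => x _; rewrite mulr_sumr; apply: eq_bigr => j _.
  by ring.
rewrite big_split /= exchange_big /=; congr (_ + _); apply: eq_bigr => x _.
by rewrite pq mulr_sumr.
Qed.
End Gram.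

(** * The essential supremum and membership in the Steklov class *)

Section Steklov_class.
Variable R : realType.
Local Notation T := (measurableTypeR R).
Local Notation leb := (@lebesgue_measure R).

Lemma continuous_horner_cis (p : {poly R[i]}) :
  continuous (fun x : R => complex.Re p.[cis x]) /\
  continuous (fun x : R => complex.Im p.[cis x]).
Proof.
elim/poly_ind: p => [|p c [cr ci]].
  by split=> x; under eq_fun do rewrite horner0; exact: cst_continuous.
split=> x.
- have -> : (fun x => complex.Re (p * 'X + c%:P).[cis x]) =
     (fun x : R => complex.Re p.[cis x] * cos x - complex.Im p.[cis x] * sin x
       + complex.Re c).
    by apply/funext => y; rewrite !hornerE /=; case: (p.[cis y]) c => a b [].
  apply: cvgD; last exact: cvg_cst.
  by apply: cvgB; apply: cvgM;
    [exact: cr|exact: continuous_cos|exact: ci|exact: continuous_sin].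
- have -> : (fun x => complex.Im (p * 'X + c%:P).[cis x]) =
     (fun x : R => complex.Re p.[cis x] * sin x + complex.Im p.[cis x] * cos x
       + complex.Im c).
    by apply/funext => y; rewrite !hornerE /=; case: (p.[cis y]) c => a b [].
  apply: cvgD; last exact: cvg_cst.
  by apply: cvgD; apply: cvgM;
    [exact: cr|exact: continuous_sin|exact: ci|exact: continuous_cos].
Qed.

Lemma continuous_normc_cis (p : {poly R[i]}) :
  continuous (fun x : R => Normc.normc p.[cis x]).
Proof.
have [cr ci] := continuous_horner_cis p => x.
pose g (y : R) := complex.Re p.[cis y] * complex.Re p.[cis y] +
                  complex.Im p.[cis y] * complex.Im p.[cis y].
have -> : (fun x : R => Normc.normc p.[cis x]) = Num.sqrt \o g.
  by apply/funext => y; rewrite /g /=; case: (p.[cis y]) => a b /=; rewrite !expr2.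
apply: continuous_comp; last exact: sqrt_continuous.
by apply: cvgD; apply: cvgM; [exact: cr|exact: cr|exact: ci|exact: ci].
Qed.

(** By continuity, any value below $|p(1)|$ is exceeded on an interval around the angle 0. That
    interval lies inside the period and has positive length, so such a value is not an essential
    upper bound. *)
Lemma le_Linfty_norm (p : {poly R[i]}) : ((Normc.normc p.[1])%:E <= Linfty_norm p)%E.
Proof.
rewrite /Linfty_norm unlock.
set mu := (mu in ess_sup mu _).
have muE A : mu A = leb (A `&` angles R) by [].
have muT : (0 < mu [set: T])%E.
  by rewrite muE setTI lebesgue_angles lte_fin mulr_gt0 // pi_gt0.
rewrite muT; apply: le_ereal_inf_tmp => y /= [N [mN N0 sub]].
rewrite leNgt; apply/negP => ylt.
pose f (x : R) : R := Normc.normc p.[cis x].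
have f0 : f 0 = Normc.normc p.[1] by rewrite /f /cis cos0 sin0.
have near0 : \forall x \near (0 : R), (y < (f x)%:E)%E /\ `|x| < pi.
  have lt_pi := nbhs0_lt (V := R) (pi_gt0 R).
  suff yf : \forall x \near (0 : R), (y < (f x)%:E)%E by near=> x; split; near: x.
  case: y ylt {sub} => [r| |].
  - rewrite lte_fin -f0 => rf.
    have rn : \forall x \near (0 : R), r < f x.
      have cf : f x @[x --> (0 : R)] --> f 0 by exact: continuous_normc_cis.
      by move/cvgr_gt : cf; apply.
    by near=> x; rewrite lte_fin; near: x.
  - by rewrite ltNge leey.
  - by move=> _; near=> x; rewrite ltNyr.
have [e /= e0 eN] := near0.
pose I : set R := `]- e, e[%classic.
have : (leb I <= mu N)%E.
  rewrite muE; apply: le_measure; rewrite ?inE.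
  - exact: measurable_itv.
  - by apply: measurableI => //; exact: measurable_angles.
  move=> x; rewrite /I /= in_itv /= => xe; have /eN[yx xpi] : ball (0 : R) e x.
    by rewrite /ball /= sub0r normrN ltr_norml.
  have xang : angles R x.
    by move: xpi; rewrite /angles /= in_itv /= ltr_norml => /andP[/ltW -> ->].
  split=> //; apply: sub => /=; apply/negP; rewrite -ltNge /=.
  by rewrite ger0_norm //; case: (p.[cis x]) => a b; exact: sqrtr_ge0.
rewrite (_ : mu N = 0) // /I lebesgue_measure_itv /= lte_fin gtrN //.
rewrite -EFinB lee_fin opprK.
by rewrite leNgt addr_gt0.
Unshelve. all: by end_near.
Qed.

Lemma dist_seq_gt0 (s : seq R) (x : R) : x \notin s ->
  exists2 e : R, 0 < e & {in s, forall y, e <= `|x - y|}.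
Proof.
elim: s => [|z s IH]; first by exists 1.
rewrite inE negb_or => /andP[xz /IH[e e0 eP]].
exists (Num.min e `|x - z|); first by rewrite lt_min e0 normr_gt0 subr_eq0.
move=> y; rewrite inE => /predU1P[->|/eP]; first by rewrite ge_min lexx orbT.
by move=> ey; rewrite ge_min ey.
Qed.

(** Off the atoms and the endpoint $-\pi$, short arcs meet no atom and stay inside the period, so
    the quotient is eventually the constant $\delta / 2\pi$. The excluded set is finite, hence
    null. *)
Lemma atomic_Steklov (delta : R) (sigma : probability T R) (L : seq (R * R)) :
  0 < delta -> (forall A, measurable A ->
    sigma A = ((delta / (2 * pi))%:E * leb (A `&` angles R) +
      \sum_(p <- L) p.1%:E * \d_(p.2) A)%E) ->
  sigma (angles R) = 1%E -> Steklov delta sigma.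
Proof.
move=> d0 sE s1; split=> //.
pose F := [set` (- pi : R) :: [seq p.2 | p <- L]] : set R.
have cF : countable F by apply: finite_set_countable; exact: finite_seq.
exists F; split.
- exact: countable_measurable.
- exact: countable_lebesgue_measure0.
move=> x /= Hx; apply: contrapT => xF; apply: Hx => /= xang.
exists (delta / (2 * pi)) => //.
have /dist_seq_gt0[e e0 eP] : x \notin (- pi : R) :: [seq p.2 | p <- L] by apply/negP.
have [xpi1 xpi2] : - pi < x /\ x < pi.
  move: xang; rewrite /angles /= in_itv /= => /andP[xge xlt]; split=> //.
  rewrite lt_neqAle xge andbT; apply/eqP => xE; apply: xF.
  by rewrite /F /= -xE mem_head.
apply: cvg_near_cst; near=> r.
have r0 : 0 < r by near: r; exact: nbhs_right_gt.
have re : r < e by near: r; exact: nbhs_right_lt.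
have rpi : r < pi - x by near: r; apply: nbhs_right_lt; rewrite subr_gt0.
have rpi' : r < x + pi by near: r; apply: nbhs_right_lt; rewrite -ltrBlDr sub0r.
rewrite sE; last exact: measurable_itv.
rewrite setIidl; last first.
  move=> y /=; rewrite /angles /= !in_itv /= => /andP[h1 h2].
  by apply/andP; split; lra.
rewrite big_seq big1 => [|p pL].
  rewrite adde0 lebesgue_measure_itv /= lte_fin ifT; last by lra.
  rewrite -EFinB -EFinM /= (_ : x + r - (x - r) = 2 * r); last by ring.
  by rewrite mulfK // mulf_neq0 // gt_eqF.
rewrite diracE memNset ?mule0 //= in_itv /= => /andP[h1 h2].
have : e <= `|x - p.2| by apply: eP; rewrite inE map_f ?orbT.
rewrite leNgt => /negP; apply; rewrite (lt_trans _ re) // ltr_norml.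
by apply/andP; split; lra.
Unshelve. all: by end_near.
Qed.

End Steklov_class.

(** * The lower bound for [M] *)

Lemma Steklov_large (R : realType) (delta : R) (n J : nat) :
  (2 * 16 ^ J <= n.+1)%N -> (n.+1 < 32 * 16 ^ J)%N ->
  0 < delta -> 6144 * 18 * Num.sqrt delta <= 1 ->
  ((4 ^+ J / (12 * Num.sqrt delta))%:E <= M n delta)%E.
Proof.
move=> leJ ltJ d0 d1; pose t := Num.sqrt delta.
have t0 : 0 < t by rewrite sqrtr_gt0.
have tt : t ^+ 2 = delta by rewrite sqr_sqrtr // ltW.
have tC0 : 0 < t%:C%C by rewrite ltcR.
have tC1 : 6144 * 18 * t%:C%C <= 1.
  by move: d1; rewrite -/t -lecR !rmorphM /= !rmorph_nat rmorph1.
have [rs [m [phi [rsP mE szphi ortho big]]]] :=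
  @orthonormal_large R[i] n J _ leJ ltJ tC0 tC1.
clear leJ ltJ tC0 tC1 d1.
have ex x : exists th : R, x \in rs -> angles R th /\ cis th = x.
  have [xrs|] := boolP (x \in rs); last by exists 0.
  by have [th th1 th2] := cis_surj (proj1 (rsP x xrs)); exists th.
have [ang angP] := choice ex.
have m_gt0 x : x \in rs -> 0 < complex.Re (m x) by move=> /rsP[_]; rewrite ltcE => /andP[].
have m_ge0 : {in rs, forall x, 0 <= m x} by move=> x /rsP[_ /ltW].
pose L := [seq (complex.Re (m x), ang x) | x <- rs].
have c0 : 0 <= delta / (2 * pi) by rewrite divr_ge0 ?mulr_ge0 ?pi_ge0 // ltW.
have [p pL|mu [mu_fin [muE mu_int]]] := @atomic_measure R (delta / (2 * pi)) L c0.
  case/mapP: pL => x xrs -> /=; split; first exact/ltW/m_gt0.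
  by case: (angP x xrs).
(* The density has mass $\delta$ over the period and the atoms have mass $1 - t^2 = 1 - \delta$. *)
have mu1 A : measurable A -> (angles R `<=` A)%classic -> mu A = 1%E.
  move=> mA angA; rewrite muE // setIidr // lebesgue_angles -EFinM.
  rewrite divfK ?mulf_neq0 ?gt_eqF ?pi_gt0 //.
  rewrite big_map big_seq.
  under eq_bigr => x xrs.
    rewrite diracE mem_set; last by apply: angA; case: (angP x xrs).
    rewrite mule1.
    over.
  rewrite -big_seq sumEFin -EFinD; congr EFin.
  have -> : \sum_(x <- rs) complex.Re (m x) = complex.Re (\sum_(x <- rs) m x).
    by rewrite raddf_sum.
  by rewrite mE -rmorphXn /= tt addrC subrK.
have muT : mu [set: R]%classic = 1%E by apply: mu1; [exact: measurableT | exact: subsetT].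
(* [mu] already has mass 1; normalizing it only packages it as a probability. *)
pose sigma := mnormalize mu (@dirac _ (measurableTypeR R) 0 R).
have sigmaE A : sigma A = mu A.
  by rewrite /sigma /mnormalize /= muT onee_eq0 /= invr1 mule1.
have sigma_int f : tame f -> \int[sigma]_(x in angles R) f x =
  delta / (2 * pi) * (\int[@lebesgue_measure R]_(x in angles R) f x) +
  \sum_(x <- rs) complex.Re (m x) * f (ang x).
  move=> tf; have := mu_int f tf; rewrite big_map => <-.
  by congr fine; apply: eq_measure_integral => A _ _; exact: sigmaE.
have Sd : Steklov delta sigma.
  apply: (@atomic_Steklov _ _ _ L) => // [A mA|].
    exact: etrans (sigmaE A) (muE A mA).
  by apply: etrans (sigmaE _) (mu1 _ _ _) => //; exact: measurable_angles.
apply: (@le_trans _ _ (Linfty_norm (phi n))); last first.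
  apply: ereal_sup_ubound.
  exists sigma, phi; split=> //.
  split=> // k l; rewrite (@cintegral_ip R sigma delta rs m ang) //.
    by move: (ortho k l); rewrite -rmorphXn /= tt.
  by move=> x /angP[].
apply: le_trans (le_Linfty_norm _); rewrite lee_fin.
rewrite ler_pdivrMr ?mulr_gt0 // mulrC -lecR rmorphXn !rmorphM /= !rmorph_nat.
have -> : (Normc.normc (phi n).[1])%:C%C = `|(phi n).[1]| by case: (_.[_]).
exact: big.
Qed.

Lemma exists_scale (n : nat) : (1 <= n)%N ->
  exists J, (2 * 16 ^ J <= n.+1)%N /\ (n.+1 < 32 * 16 ^ J)%N.
Proof.
(* With $h$ the integer half of $n + 1$, positive since $n \ge 1$, this $J$ satisfies $16^J \le h <
   16^{J+1}$. *)
move=> n1; exists (trunc_log 16 n.+1./2).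
have /(trunc_log_bounds (isT : 1 < 16)%N)/andP[] : (0 < n.+1./2)%N by lia.
by rewrite expnS; lia.
Qed.

Lemma sqrt_lt_scale (R : realType) (n J : nat) : (n.+1 < 32 * 16 ^ J)%N ->
  Num.sqrt n%:R < 6 * 4 ^+ J :> R.
Proof.
(* 32 is rounded up to the square 36. *)
move=> ltJ; rewrite -[X in _ < X](@ger0_norm _ _) ?mulr_ge0 ?exprn_ge0 // -sqrtr_sqr.
rewrite ltr_sqrt ?exprn_gt0 ?mulr_gt0 ?exprn_gt0 // exprMn exprAC -!natrX -natrM ltr_nat.
by rewrite (_ : 4 ^ 2 = 16)%N //; lia.
Qed.

Unset Implicit Arguments.

Theorem theorem3p2 (R : realType) :
  exists delta0 : R, 0 < delta0 /\
    forall delta : R, 0 < delta -> delta < delta0 ->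
      exists C : R, 0 < C /\
        forall n : nat, (1 <= n)%N ->
          ((C * Num.sqrt n%:R)%:E < M n delta)%E.
Proof.
have [K K0 KE] : exists2 K : R, 0 < K & K = 6144 * 18.
  by exists (6144 * 18); first by apply: mulr_gt0; rewrite ltr0n.
(* Below this threshold $K \sqrt\delta \le 1$, the smallness that [Steklov_large] asks for. *)
exists (K^-1 ^+ 2); split; first by rewrite exprn_gt0 ?invr_gt0.
move=> delta d0 d1.
have t0 : 0 < Num.sqrt delta by rewrite sqrtr_gt0.
have t1 : 6144 * 18 * Num.sqrt delta <= 1.
  rewrite -KE -ler_pdivlMl // mulr1.
  rewrite -[X in _ <= X](@ger0_norm _ _) ?invr_ge0 ?(ltW K0) // -sqrtr_sqr.
  by rewrite ler_sqrt ?exprn_ge0 ?invr_ge0 ?(ltW K0) // ltW.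
clear KE.
(* $72 = 12 \cdot 6$: the 12 of [Steklov_large] and the 6 in $\sqrt n < 6 \cdot 4^J$. *)
exists (72 * Num.sqrt delta)^-1; split; first by rewrite invr_gt0 mulr_gt0.
move=> n /exists_scale[J [leJ ltJ]].
apply: lt_le_trans (@Steklov_large R delta n J leJ ltJ d0 t1); rewrite lte_fin.
have n_lt := @sqrt_lt_scale R n J ltJ.
clear t1 leJ ltJ.
have -> : 4 ^+ J / (12 * Num.sqrt delta) = (72 * Num.sqrt delta)^-1 * (6 * 4 ^+ J).
  by field; rewrite gt_eqF.
by rewrite ltr_pM2l // invr_gt0 mulr_gt0.
Qed.
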